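(* Let $N\ge 1$ be a natural number and $h=\frac1N$. Consider quadrature formulas $$\int_0^1\varphi(x)\,dx\cong\sum_{\beta=0}^N\bigl(C_0[\beta]\varphi(h\beta)+C_1[\beta]\varphi'(h\beta)\bigr),$$ where $C_0[0]=C_0[N]=\frac h2$ and $C_0[\beta]=h$ for $1\le\beta\le N-1$ are fixed, and the real coefficients $C_1[0],\dots,C_1[N]$ are free subject to the formula being exact for $\varphi(x)=e^{-x}$. The optimal coefficients $C_1[\beta]$ in the sense of Sard in the space $W_2^{(2,1)}(0,1)$, i.e. those for which the norm $\|\ell|W_2^{(2,1)*}(0,1)\|$ of the error functional attains its infimum over all admissible choices of $C_1[0],\dots,C_1[N]$, are $$\mathring C_1[0]=\frac{h(e^h+1)}{2(e^h-1)}-1,\qquad \mathring C_1[\beta]=0\ \ (\beta=1,2,\dots,N-1),\qquad \mathring C_1[N]=1-\frac{h(e^h+1)}{2(e^h-1)}.$$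
   Context: $W_2^{(2,1)}(0,1)$ is the class of real functions $\varphi$ on $[0,1]$ having an absolutely continuous first derivative and second derivative in $L_2(0,1)$, with the semi-norm $$\|\varphi|W_2^{(2,1)}(0,1)\|=\Bigl[\int_0^1(\varphi''(x)+\varphi'(x))^2dx\Bigr]^{1/2}$$ (functions differing by a linear combination of $1$ and $e^{-x}$ are identified, which makes it a Hilbert space). The error functional of the quadrature formula is $$(\ell,\varphi)=\int_0^1\varphi(x)\,dx-\sum_{\beta=0}^N\bigl(C_0[\beta]\varphi(h\beta)+C_1[\beta]\varphi'(h\beta)\bigr).$$ For it to be well defined on $W_2^{(2,1)}(0,1)$ one requires $(\ell,1)=0$ (which holds automatically for the given $C_0[\beta]$) and $(\ell,e^{-x})=0$, i.e. $\int_0^1e^{-x}dx=\sum_{\beta=0}^N(C_0[\beta]-C_1[\beta])e^{-h\beta}$; this last equation is the constraint of admissibility on the $C_1[\beta]$. The norm of $\ell$ is $$\|\ell|W_2^{(2,1)*}(0,1)\|=\sup_{\|\varphi|W_2^{(2,1)}(0,1)\|=1}|(\ell,\varphi)|.$$ *)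

(* Defs.v *)
From HB Require Import structures.
From mathcomp Require Import all_boot all_order all_algebra.
From mathcomp Require Import all_classical all_reals all_analysis.

Set Implicit Arguments.
Unset Strict Implicit.
Unset Printing Implicit Defensive.

Import Order.TTheory GRing.Theory Num.Theory.
Import numFieldNormedType.Exports.

Local Open Scope classical_set_scope.
Local Open Scope ring_scope.

(* A function on [0,1] is represented by a function R -> R of which only the
   values on [0,1] are ever used: every derivative below is relative to [0,1],
   hence one-sided at the end points. *)

Definition diff_quot01 (R : realType) (f : R -> R) (x : R) : set_system R :=
  (f y - f x) / (y - x) @[y --> within `[0, 1] x^'].

Definition derivable01 (R : realType) (f : R -> R) (x : R) : Prop :=
  cvg (diff_quot01 f x).

(* Meaningful only where [derivable01 f x] holds; elsewhere [lim] returns a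
   fixed default value. *)
Definition deriv01 (R : realType) (f : R -> R) (x : R) : R :=
  lim (diff_quot01 f x).

Definition abs_continuous01 (R : realType) (f : R -> R) : Prop :=
  forall e : R, 0 < e -> exists2 d : R, 0 < d &
    forall (n : nat) (a b : 'I_n -> R),
      (forall i, 0 <= a i /\ a i <= b i /\ b i <= 1) ->
      trivIset [set: 'I_n] (fun i => `]a i, b i[%classic) ->
      \sum_(i < n) (b i - a i) < d ->
      \sum_(i < n) `|f (b i) - f (a i)| < e.

Definition square_integrable01 (R : realType) (g : R -> R) : Prop :=
  measurable_fun (`]0, 1[ : set (measurableTypeR R)) g /\
  lebesgue_measure.-integrable `]0, 1[ (fun x => (g x ^+ 2)%:E).

Definition W221 (R : realType) (phi : R -> R) : Prop :=
  [/\ forall x : R, 0 <= x <= 1 -> derivable01 phi x,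
      abs_continuous01 (deriv01 phi),
      {ae (@lebesgue_measure R), forall x : R,
         0 < x < 1 -> derivable01 (deriv01 phi) x}
    & square_integrable01 (deriv01 (deriv01 phi))].

Definition W221_seminorm (R : realType) (phi : R -> R) : R :=
  Num.sqrt (\int[lebesgue_measure]_(x in `]0, 1[)
              (deriv01 (deriv01 phi) x + deriv01 phi x) ^+ 2).

(* Extended-real valued: the supremum is +oo for a functional that is unbounded
   with respect to the semi-norm. *)
Definition W221_dual_norm (R : realType) (l : (R -> R) -> R) : \bar R :=
  ereal_sup [set `|l phi|%:E | phi in
    [set phi : R -> R | W221 phi /\ W221_seminorm phi = 1]].

Definition step (R : realType) (N : nat) : R := N%:R^-1.

Definition C0 (R : realType) (N : nat) (b : 'I_N.+1) : R :=
  if (b == ord0) || (b == ord_max) then step R N / 2 else step R N.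

Definition error_functional (R : realType) (N : nat) (C1 : 'I_N.+1 -> R)
    (phi : R -> R) : R :=
  \int[lebesgue_measure]_(x in `[0, 1]) phi x -
  \sum_(b < N.+1) (C0 R b * phi (step R N * b%:R) +
                   C1 b * deriv01 phi (step R N * b%:R)).

Definition admissible (R : realType) (N : nat) (C1 : 'I_N.+1 -> R) : Prop :=
  error_functional C1 (fun x => expR (- x)) = 0.

Definition optimal (R : realType) (N : nat) (C1 : 'I_N.+1 -> R) : Prop :=
  admissible C1 /\
  W221_dual_norm (error_functional C1) =
    ereal_inf [set W221_dual_norm (error_functional D1) | D1 in
      [set D1 : 'I_N.+1 -> R | admissible D1]].

(* Main.v *)
(** Put [psi = phi'' + phi']. Integrating by parts twice on every piece
    [[t_i, t_(i+1)]] (with [t_i = h i] and midpoint [m_i]) gives, for admissible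
    [C1], [l(phi) = sum_i int_(t_i)^(t_(i+1)) k_i psi] with
    [k_i x = c_i e^x - (x - m_i) - 1]: these are the solutions of
    [k' - k = x - m_i], and the coefficients [C1] are the jumps of [k] at the
    nodes, so that admissible [C1] correspond bijectively to arbitrary
    [c_0, ..., c_(N-1)]. The norm of [l] is the L2 norm of [k], and minimizing it
    amounts to making every [k_i] orthogonal to [e^x] on its piece. The minimizer
    is then h-periodic and continuous, i.e. has no jump at the interior nodes.

    The integration by parts needs the fundamental theorem of calculus for
    absolutely continuous functions. For the strict optimality it suffices to
    test [l] against continuous [psi], since the optimal [k] is continuous. *)
Require Import Defs.
From HB Require Import structures.
From mathcomp Require Import all_boot all_order all_algebra.
From mathcomp Require Import all_classical all_reals all_analysis.
From mathcomp Require Import measurable_realfun.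
From mathcomp Require Import ring lra.
Set Implicit Arguments.
Unset Strict Implicit.
Unset Printing Implicit Defensive.
Import Order.TTheory GRing.Theory Num.Theory.
Import numFieldNormedType.Exports.
Local Open Scope classical_set_scope.
Local Open Scope ring_scope.

(** * Derivatives relative to [[0, 1]] *)

(** Multiplying out the difference quotient admits [y = x]. [diff_quot01_dist] has the same shape,
    so two-sided and relative derivatives differ only in the points [y] allowed. *)
Lemma is_derive_dist (R : realType) (f : R -> R) (x d : R) :
  is_derive x 1 f d <->
  forall e : R, 0 < e -> exists2 r : R, 0 < r &
    forall y, `|y - x| < r -> `|f y - f x - d * (y - x)| <= e * `|y - x|.
Proof.
have -> : is_derive x 1 f d <->
    (h^-1 *: (f (h *: 1 + x) - f x) @[h --> 0^'] --> d).
  split=> [[df <-] //|H].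
  by apply: DeriveDef; [apply/cvg_ex; exists d|exact/cvg_lim].
split=> [/cvgrPdist_le H e e0|H].
- have /nbhs_ballP[r /= r0 Hr] := H e e0; exists r => // y yx.
  have [->|yNx] := eqVneq y x; first by rewrite !subrr mulr0 subr0 !normr0 mulr0.
  have yx0 : y - x != 0 by rewrite subr_eq0.
  have := Hr (y - x); rewrite /ball/= sub0r normrN => /(_ yx yx0).
  rewrite [_ *: 1]mulr1 subrK => H1.
  rewrite -ler_pdivrMr ?normr_gt0// -normf_div; apply: le_trans H1.
  rewrite distrC (_ : _ / _ = (y - x)^-1 *: (f y - f x) - d)//.
  by rewrite /GRing.scale/=; field.
- apply/cvgrPdist_le => e e0; have [r r0 Hr] := H e e0.
  apply/nbhs_ballP; exists r => //= h; rewrite /ball/= sub0r normrN => hr h0.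
  have := Hr (h + x); rewrite addrK => /(_ hr).
  rewrite [h *: 1]mulr1 -ler_pdivrMr ?normr_gt0// -normf_div distrC.
  by move=> /(le_trans _); apply; rewrite /GRing.scale/= le_eqVlt;
    apply/orP; left; apply/eqP; congr `|_|; field.
Qed.

(** Every punctured neighbourhood of a point of [0, 1] meets [0, 1]; this makes the limits behind
    [deriv01] unique. *)
Lemma within01_proper (R : realType) (x : R) : 0 <= x <= 1 ->
  ProperFilter (within `[0, 1] x^').
Proof.
move=> x01; apply: Build_ProperFilter_ex => A.
move/nbhs_ballP => [r /= r0 H].
(* With [t] at most 1/2, one of [x + t] and [x - t] stays in [0, 1], according to the half that
   contains [x]. *)
pose t := Num.min (r / 2) (1 / 2).
have t0 : 0 < t by rewrite lt_min; apply/andP; split; lra.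
have tr : t < r by rewrite gt_min; apply/orP; left; lra.
have t2 : t <= 1 / 2 by rewrite ge_min lexx orbT.
have key y : `|y - x| = t -> 0 <= y <= 1 -> A y.
  move=> yx y01; apply: H; rewrite /ball/= ?in_itv//=.
    by rewrite distrC yx.
  by rewrite -subr_eq0 -normr_gt0 yx.
have [xl|xl] := leP x (1 / 2).
- exists (x + t); apply: key; last lra.
  by rewrite addrAC subrr add0r gtr0_norm.
- exists (x - t); apply: key; last lra.
  by rewrite addrAC subrr add0r normrN gtr0_norm.
Qed.

Lemma diff_quot01_dist (R : realType) (f : R -> R) (x d : R) :
  (diff_quot01 f x --> d) <->
  forall e : R, 0 < e -> exists2 r : R, 0 < r &
    forall y, 0 <= y <= 1 -> `|y - x| < r ->
      `|f y - f x - d * (y - x)| <= e * `|y - x|.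
Proof.
split=> [/cvgrPdist_le H e e0|H].
- have /nbhs_ballP[r /= r0 Hr] := H e e0; exists r => // y y01 yx.
  have [->|yNx] := eqVneq y x; first by rewrite !subrr mulr0 subr0 !normr0 mulr0.
  have yx0 : y - x != 0 by rewrite subr_eq0.
  have := Hr y; rewrite /ball/= distrC in_itv/= => /(_ yx yNx y01) H1.
  rewrite -ler_pdivrMr ?normr_gt0// -normf_div; apply: le_trans H1.
  by rewrite distrC (_ : _ / _ = (f y - f x) / (y - x) - d)//; field.
- apply/cvgrPdist_le => e e0; have [r r0 Hr] := H e e0.
  apply/nbhs_ballP; exists r => //= y; rewrite /ball/= distrC in_itv/=.
  move=> yx yNx y01; have yx0 : y - x != 0 by rewrite subr_eq0.
  have := Hr y y01 yx.
  rewrite -ler_pdivrMr ?normr_gt0// -normf_div distrC.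
  by congr (`|_| <= _); field.
Qed.

Lemma deriv01_cvg (R : realType) (f : R -> R) (x d : R) : 0 <= x <= 1 ->
  (diff_quot01 f x --> d) -> derivable01 f x /\ deriv01 f x = d.
Proof.
move=> x01 H; have := within01_proper x01 => P.
by split; [apply/cvg_ex; exists d|exact/cvg_lim].
Qed.

Lemma is_derive_diff_quot01 (R : realType) (f : R -> R) (x d : R) :
  is_derive x 1 f d -> diff_quot01 f x --> d.
Proof.
move=> /is_derive_dist H; apply/diff_quot01_dist => e /H[r r0 Hr].
by exists r => // y _; exact: Hr.
Qed.

Lemma diff_quot01_is_derive (R : realType) (f : R -> R) (x d : R) : 0 < x < 1 ->
  diff_quot01 f x --> d -> is_derive x 1 f d.
Proof.
move=> /andP[x0 x1] /diff_quot01_dist H; apply/is_derive_dist => e /H[r r0 Hr].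
(* This radius keeps the whole ball around [x] inside [0, 1]. *)
exists (Num.min r (Num.min x (1 - x))).
  by rewrite !lt_min r0 x0 subr_gt0.
move=> y; rewrite !lt_min => /and3P[yr yx yx1]; apply: Hr => //.
by apply/andP; move: yx yx1; rewrite !ltr_norml => /andP[? ?] /andP[? ?];
  split; lra.
Qed.

Lemma derivable01_is_derive (R : realType) (f : R -> R) (x : R) : 0 < x < 1 ->
  derivable01 f x -> is_derive x 1 f (deriv01 f x).
Proof. by move=> x01 fx; exact: diff_quot01_is_derive. Qed.

(** This lets [deriv01 phi] be replaced, under a further derivative, by a formula valid on [0, 1]
    alone. *)
Lemma eq_diff_quot01 (R : realType) (f g : R -> R) (x : R) : 0 <= x <= 1 ->
  (forall y, 0 <= y <= 1 -> f y = g y) -> diff_quot01 f x --> diff_quot01 g x.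
Proof.
move=> x01 fg; apply: near_eq_cvg; apply/nbhs_ballP; exists 1 => //= y _ _ /=.
by rewrite in_itv/= => y01; rewrite !fg.
Qed.

(** * Absolutely continuous functions *)

(** The intervals are listed from right to left, so that prolonging a chain to the right is a cons;
    [x] bounds the rightmost one. *)
Fixpoint chain (R : realType) (s : seq (R * R)) (x : R) : Prop :=
  if s is p :: s' then [/\ p.1 <= p.2, p.2 <= x & chain s' p.1] else 0 <= x.

Lemma chain_ge0 (R : realType) (s : seq (R * R)) (x : R) : chain s x -> 0 <= x.
Proof.
elim: s x => [//|p s IH] x /= [p12 p2x /IH p0].
exact: le_trans p0 (le_trans p12 p2x).
Qed.

Lemma chain_le (R : realType) (s : seq (R * R)) (x y : R) : x <= y ->
  chain s x -> chain s y.
Proof.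
case: s => [|p s] xy /=; first by move=> /le_trans; apply.
by case=> p12 p2x sp; split=> //; exact: le_trans xy.
Qed.

Lemma chain_nth (R : realType) (s : seq (R * R)) (x : R) (i : nat) :
  chain s x -> (i < size s)%N ->
  [/\ 0 <= (nth (0, 0) s i).1, (nth (0, 0) s i).1 <= (nth (0, 0) s i).2
    & (nth (0, 0) s i).2 <= x].
Proof.
elim: s x i => [//|p s IH] x [|i] /= [p12 p2x cs].
  by move=> _; split=> //; exact: chain_ge0 cs.
rewrite ltnS => /(IH _ _ cs)[? ? ?]; split=> //.
by apply: le_trans (le_trans p12 p2x).
Qed.

Lemma chain_nth_lt (R : realType) (s : seq (R * R)) (x : R) (i j : nat) :
  chain s x -> (i < j < size s)%N -> (nth (0, 0) s j).2 <= (nth (0, 0) s i).1.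
Proof.
elim: s x i j => [|p s IH] x i j; first by rewrite andbF.
case: j => // j; case: i => [|i] /= [p12 p2x cs].
  by rewrite ltnS => /(chain_nth cs)[].
by rewrite !ltnS; exact: IH cs.
Qed.

Lemma abs_continuous01_chain (R : realType) (f : R -> R) :
  abs_continuous01 f -> forall e : R, 0 < e -> exists2 d : R, 0 < d &
    forall s, chain s 1 -> \sum_(p <- s) (p.2 - p.1) < d ->
      \sum_(p <- s) `|f p.2 - f p.1| < e.
Proof.
move=> acf e /acf[d d0 Hd]; exists d => // s cs.
rewrite !(big_nth (0, 0)) !big_mkord; apply: Hd.
- by move=> i; have [? ? ?] := chain_nth cs (ltn_ord i).
- apply/trivIsetP => i j _ _ ij.
  wlog lt_ij : i j ij / (i < j)%N => [hw|].
    have [|] := ltnP i j; first exact: hw.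
    rewrite leq_eqVlt eq_sym => /predU1P[/val_inj/eqP|ji].
      by rewrite (negbTE ij).
    by rewrite setIC; apply: hw => //; rewrite eq_sym.
  rewrite -subset0 => y [/=]; rewrite !in_itv/= => /andP[ay _] /andP[_ yb].
  have := chain_nth_lt cs (i := i) (j := j); rewrite lt_ij ltn_ord => /(_ isT).
  by move=> /(lt_le_trans yb); rewrite ltNge (ltW ay).
Qed.

(** The head, taken half-open, and the part of [U] below [p.1] are disjoint, so the induction adds
    their measures; the cut of [U] at [x] carries this through. *)
Lemma chain_length_le (R : realType) (s : seq (R * R)) (x : R) (U : set R) :
  open U -> chain s x -> (forall p, p \in s -> `[p.1, p.2] `<=` U) ->
  ((\sum_(p <- s) (p.2 - p.1))%:E <= lebesgue_measure (U `&` `]-oo, x[))%E.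
Proof.
move=> /open_measurable mU; elim: s x => [|p s IH] x /=.
  by rewrite big_nil => *; exact: measure_ge0.
move=> [p12 p2x cs] sU; rewrite big_cons EFinD.
have mi (i : interval R) : measurable [set` i] by exact: measurable_itv.
apply: (@le_trans _ _ (lebesgue_measure ([set` `[p.1, p.2[] `|`
    (U `&` [set` `]-oo, p.1[])))); last first.
  apply: le_measure; rewrite ?inE.
  - by apply: measurableU => //; exact: measurableI.
  - exact: measurableI.
  - move=> y [|[Uy]] /=; rewrite !in_itv/=.
      move=> /andP[py yp]; split; last exact: lt_le_trans p2x.
      by apply: (sU p); rewrite ?mem_head//= in_itv/= py ltW.
    by move=> yp; split=> //; apply: lt_le_trans (le_trans p12 p2x).
rewrite measureU//; [|exact: measurableI|].
  apply: leeD; last first.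
    by apply: IH => // q qs; apply: sU; rewrite inE qs orbT.
  have := lebesgue_measure_itv `[p.1, p.2[; rewrite /= lte_fin => ->.
  by case: ltP => // H; rewrite lee_fin subr_le0.
rewrite -subset0 => y [/=]; rewrite !in_itv/= => /andP[py _] [_].
by rewrite ltNge py.
Qed.

(* A sup argument in place of Cousin's lemma: one goes from 0 to any x by
   steps on which either the difference quotient of f is at most e, or which
   lie in an open set U of measure < d covering the exceptional points. *)
Lemma abs_continuous01_derive0_le (R : realType) (f : R -> R) :
  abs_continuous01 f ->
  {ae (@lebesgue_measure R), forall x : R, 0 < x < 1 -> is_derive x 1 f 0} ->
  forall x e : R, 0 <= x <= 1 -> 0 < e -> `|f x - f 0| <= e * x + e.
Proof.
move=> acf aef x e x01 e0.
have [d d0 Hd] := abs_continuous01_chain acf e0.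
(* The exceptional points; 0 and 1 join them since the hypothesis concerns interior points only. *)
pose N := [set x : R | ~ (0 < x < 1 -> is_derive x 1 f 0)] `|` [set 0; 1].
have : lebesgue_measure.-negligible N.
  apply: negligibleU => //; apply: negligibleU; apply/negligibleP => //;
  exact: lebesgue_measure_set1.
move=> /negligible_outer_measure N0.
have [|U [oU NU]] := @outer_measure_open_le R N (d / 2); first lra.
rewrite N0 add0e => muU.
(* Around a point of [U] a short interval stays in [U]. Around any other point the derivative
   estimate, used on both sides of [c], adds up to [e * (z - y)]. *)
have local (c : R) : 0 <= c <= 1 -> exists2 r, 0 < r & forall y z,
    0 <= y -> z <= 1 -> c - r < y -> y <= c -> c <= z -> z < c + r ->
    `[y, z] `<=` U \/ `|f z - f y| <= e * (z - y).
  move=> c01; have [Uc|nUc] := pselect (U c).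
    have /nbhs_ballP[r /= r0 Hr] : nbhs c U by exact: open_nbhs_nbhs.
    exists r => // y z _ _ cy yc cz zc; left => t /=.
    rewrite in_itv/= => /andP[yt tz]; apply: Hr.
    by rewrite /ball/= ltr_norml; lra.
  have c01' : 0 < c < 1.
    have cN0 : c <> 0 by move=> cE; apply: nUc; apply: NU; right; left.
    have cN1 : c <> 1 by move=> cE; apply: nUc; apply: NU; right; right.
    move: c01 => /andP[]; rewrite le_eqVlt => /predU1P[/esym//|->].
    by rewrite le_eqVlt => /predU1P[//|->].
  have : is_derive c 1 f 0.
    apply: contrapT => nd; apply: nUc; apply: NU; left => /(_ c01').
    exact: nd.
  move=> /is_derive_dist/(_ _ e0)[r r0 Hr]; exists r => //.
  move=> y z _ _ cy yc cz zc; right.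
  have := Hr y; rewrite mul0r subr0 ltr_norml => /(_ ltac:(lra)).
  rewrite [`|y - c|]ler0_norm ?subr_le0// => H1.
  have := Hr z; rewrite mul0r subr0 ltr_norml => /(_ ltac:(lra)).
  rewrite [`|z - c|]ger0_norm ?subr_ge0// => H2.
  rewrite (_ : f z - f y = (f z - f c) - (f y - f c)); last by ring.
  apply: le_trans (ler_normB _ _) _; lra.
(* The points reached from 0: steps of small slope are paid by [e * y], steps inside [U] are
   recorded in the chain [s]. *)
pose T := [set y : R | 0 <= y <= x /\ exists s, [/\ chain s y,
   forall p, p \in s -> `[p.1, p.2] `<=` U &
   `|f y - f 0| <= e * y + \sum_(p <- s) `|f p.2 - f p.1|]].
have step y z : T y -> y <= z -> z <= x ->
    (`[y, z] `<=` U \/ `|f z - f y| <= e * (z - y)) -> T z.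
  move=> [y01 [s [cs sU fs]]] yz zx yzU; split; first lra.
  have fzy : `|f z - f 0| <= `|f z - f y| + `|f y - f 0|.
    by rewrite (_ : f z - f 0 = (f z - f y) + (f y - f 0)) ?ler_normD//; ring.
  case: yzU => H.
    exists ((y, z) :: s); split => /=.
    - by split=> //; lra.
    - by move=> p; rewrite inE => /predU1P[->//|/sU].
    - rewrite big_cons/=.
      have : e * y <= e * z by rewrite ler_pM2l//; lra.
      lra.
  exists s; split=> //; first by apply: chain_le cs; lra.
  lra.
have T0 : T 0.
  split; first by rewrite lexx; case/andP: x01.
  by exists [::]; split=> //=; rewrite big_nil subrr normr0 mulr0 addr0.
have supT : has_sup T by split; [exists 0|exists x => y [/andP[]]].
pose c := sup T.
have c0 : 0 <= c by apply: ub_le_sup => //; case: supT.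
have cx : c <= x by apply: ge_sup; [exists 0|move=> y [/andP[]]].
have [|r r0 Hr] := local c; first lra.
(* The supremum is attained: one local step leads to [c] from a point of [T] closer than [r]. *)
have Tc : T c.
  have [y Ty cy] := sup_adherent r0 supT.
  have yc : y <= c by apply: ub_le_sup => //; case: supT.
  by apply: (step y) => //; apply: Hr => //; case: Ty; lra.
(* Otherwise a local step from [c] would lead beyond the supremum. *)
have {}cx : c = x.
  apply/eqP; rewrite eq_le cx leNgt; apply/negP => cx'.
  pose z := Num.min x (c + r / 2).
  have cz : c < z by rewrite lt_min cx'; lra.
  have zx : z <= x by rewrite ge_min lexx.
  have zr : z <= c + r / 2 by rewrite ge_min lexx orbT.
  have : T z.
    apply: (step c) => //; first lra.
    by apply: Hr; lra.
  have : has_ubound T by case: supT.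
  move=> /ub_le_sup/[apply]; rewrite -/c; lra.
move: Tc; rewrite cx => -[_ [s [cs sU fs]]].
apply: le_trans fs _; rewrite lerD2l ltW//; apply: Hd.
  by apply: chain_le cs; lra.
rewrite -lte_fin; apply: le_lt_trans (chain_length_le oU cs sU) _.
apply: (@le_lt_trans _ _ (lebesgue_measure U)).
  apply: le_measure; rewrite ?inE.
  - apply: measurableI; [exact: open_measurable|exact: measurable_itv].
  - exact: open_measurable.
  - exact: subIsetl.
by apply: le_lt_trans muU _; rewrite lte_fin; lra.
Qed.

Lemma abs_continuous01_derive0 (R : realType) (f : R -> R) :
  abs_continuous01 f ->
  {ae (@lebesgue_measure R), forall x : R, 0 < x < 1 -> is_derive x 1 f 0} ->
  forall x : R, 0 <= x <= 1 -> f x = f 0.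
Proof.
move=> acf aef x x01; apply/eqP; rewrite -subr_eq0 -normr_le0.
apply/ler_addgt0Pl => e e0; rewrite addr0.
have e2 : 0 < e / 2 by lra.
have := abs_continuous01_derive0_le acf aef x01 e2.
move=> /le_trans; apply.
have : e / 2 * x <= e / 2 * 1 by rewrite ler_pM2l//; lra.
lra.
Qed.

Lemma within_continuous_dist (R : realType) (f : R -> R) (a b : R) :
  (forall x : R, a <= x <= b -> forall e : R, 0 < e -> exists2 r : R, 0 < r &
    forall y, a <= y <= b -> `|y - x| < r -> `|f y - f x| <= e) ->
  {within `[a, b], continuous f}.
Proof.
move=> H; apply/subspace_continuousP => x; rewrite /= in_itv/= => x01.
apply/cvgrPdist_le => e e0; have [r r0 Hr] := H _ x01 _ e0.
apply/nbhs_ballP; exists r => //= y; rewrite /ball/= in_itv/= => xy y01.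
by rewrite distrC; apply: Hr => //; rewrite distrC.
Qed.

Lemma within_continuous_bounded (R : realType) (f : R -> R) (a b : R) : a <= b ->
  {within `[a, b], continuous f} ->
  exists2 B : R, 0 < B & forall x, a <= x <= b -> `|f x| <= B.
Proof.
move=> ab cf; have [c _ Hc] := EVT_max ab cf; have [d _ Hd] := EVT_min ab cf.
exists (`|f c| + `|f d| + 1).
  by rewrite ltr_wpDl// addr_ge0.
move=> x x01; have xI : x \in `[a, b] by rewrite in_itv.
have fc : f x <= `|f c| := le_trans (Hc _ xI) (ler_norm _).
have fd : - `|f d| <= f x.
  by apply: le_trans (Hd _ xI); rewrite lerNl -normrN ler_norm.
have := normr_ge0 (f c); have := normr_ge0 (f d); rewrite ler_norml; lra.
Qed.

Lemma abs_continuous01_within (R : realType) (f : R -> R) :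
  abs_continuous01 f -> {within `[0, 1], continuous f}.
Proof.
move=> acf; apply: within_continuous_dist => x x01 e e0.
have [d d0 Hd] := abs_continuous01_chain acf e0.
exists d => // y y01 yxd; apply: ltW.
wlog yx : x y x01 y01 yxd / y <= x => [hw|].
  have [|/ltW] := leP y x; first exact: hw.
  by rewrite distrC; apply: hw => //; rewrite distrC.
have := Hd [:: (y, x)]; rewrite !big_seq1 /= distrC; apply; first by split; lra.
by move: yxd; rewrite ler0_norm; lra.
Qed.

Lemma lipschitz_abs_continuous01 (R : realType) (f : R -> R) (L : R) :
  (forall x y, 0 <= x -> x <= y -> y <= 1 -> `|f y - f x| <= L * (y - x)) ->
  abs_continuous01 f.
Proof.
move=> Lf e e0; pose L' := Num.max L 1.
have L'0 : 0 < L' by rewrite lt_max ltr01 orbT.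
exists (e / L'); first exact: divr_gt0.
move=> n a b ab _ sd; apply: (@le_lt_trans _ _ (L' * \sum_(i < n) (b i - a i))).
  rewrite mulr_sumr; apply: ler_sum => i _; have [ai [abi bi]] := ab i.
  apply: le_trans (Lf _ _ ai abi bi) _; apply: ler_wpM2r; first by rewrite subr_ge0.
  by rewrite le_max lexx.
by rewrite mulrC -ltr_pdivlMr.
Qed.

Lemma abs_continuous01B (R : realType) (f g : R -> R) :
  abs_continuous01 f -> abs_continuous01 g -> abs_continuous01 (fun x => f x - g x).
Proof.
move=> acf acg e e0; have e2 : 0 < e / 2 by lra.
have [d1 d10 H1] := acf _ e2; have [d2 d20 H2] := acg _ e2.
exists (Num.min d1 d2); first by rewrite lt_min d10.
move=> n a b ab tab; rewrite lt_min => /andP[s1 s2].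
have := H1 n a b ab tab s1; have := H2 n a b ab tab s2 => h2 h1.
apply: (@le_lt_trans _ _ (\sum_(i < n) (`|f (b i) - f (a i)| + `|g (b i) - g (a i)|))).
  apply: ler_sum => i _.
  rewrite (_ : _ - _ = (f (b i) - f (a i)) - (g (b i) - g (a i))); last by ring.
  exact: ler_normB.
by rewrite big_split/=; lra.
Qed.

Lemma abs_continuous01M (R : realType) (f g : R -> R) :
  abs_continuous01 f -> abs_continuous01 g -> abs_continuous01 (fun x => f x * g x).
Proof.
move=> acf acg e e0.
have [B B0 fB] := within_continuous_bounded ler01 (abs_continuous01_within acf).
have [C C0 gC] := within_continuous_bounded ler01 (abs_continuous01_within acg).
have e1 : 0 < e / (2 * C) by rewrite divr_gt0// mulr_gt0.
have e2 : 0 < e / (2 * B) by rewrite divr_gt0// mulr_gt0.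
have [d1 d10 H1] := acf _ e1; have [d2 d20 H2] := acg _ e2.
exists (Num.min d1 d2); first by rewrite lt_min d10.
move=> n a b ab tab; rewrite lt_min => /andP[s1 s2].
have := H1 n a b ab tab s1; have := H2 n a b ab tab s2 => h2 h1.
apply: (@le_lt_trans _ _ (\sum_(i < n)
    (C * `|f (b i) - f (a i)| + B * `|g (b i) - g (a i)|))).
  apply: ler_sum => i _; have [ai [abi bi]] := ab i.
  rewrite (_ : _ - _ = (f (b i) - f (a i)) * g (b i) +
    f (a i) * (g (b i) - g (a i))); last by ring.
  apply: le_trans (ler_normD _ _) _; rewrite !normrM.
  rewrite mulrC; apply: lerD; apply: ler_wpM2r => //.
    by apply: gC; lra.
  by apply: fB; lra.
rewrite big_split/= -!mulr_sumr.
rewrite ltr_pdivlMr ?mulr_gt0// in h1; rewrite ltr_pdivlMr ?mulr_gt0// in h2.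
nra.
Qed.

(** * Primitives of integrable functions and the fundamental theorem of calculus *)

Section PrimitiveAbsContinuous.
Variable R : realType.
Local Notation mu := (@lebesgue_measure R).
Variable f : R -> R.
Hypothesis intf : mu.-integrable [set: R] (EFin \o f).
Let F (x : R) : R := \int[mu]_(t in `]-oo, x]) f t.

Lemma primitiveB (x y : R) : x <= y -> F y - F x = \int[mu]_(t in `]x, y]) f t.
Proof.
move=> xy; rewrite /F Rintegral_itvB//.
by apply: integrableS intf => //; exact: measurable_itv.
Qed.

(** Absolute continuity of the integral, applied to the union of the disjoint intervals. *)
Lemma primitive_abs_continuous01 : abs_continuous01 F.
Proof.
move=> e e0; have [d [d0 Hd]] := integral_normr_continuous intf e0.
exists d => // n a b ab tab sd.
pose I (i : 'I_n) : set R := `]a i, b i[%classic.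
have mI i : measurable (I i : set (measurableTypeR R)) by exact: measurable_itv.
have intS A : measurable A -> mu.-integrable A (EFin \o f).
  by move=> mA; apply: integrableS intf.
have intnS A : measurable A -> mu.-integrable A (EFin \o (fun x => `|f x|)).
  by move=> /intS/integrable_norm.
apply: (@le_lt_trans _ _ (\sum_(i < n) \int[mu]_(t in I i) `|f t|)).
  apply: ler_sum => i _; have [ai [abi bi]] := ab i.
  rewrite primitiveB// -Rintegral_itv_bndo_bndc; last exact: intS (measurable_itv _).
  by apply: le_normr_Rintegral => //; exact: intS.
have mU : measurable (\big[setU/set0]_(i < n) I i : set (measurableTypeR R)).
  exact: bigsetU_measurable.
have -> : \sum_(i < n) \int[mu]_(t in I i) `|f t| =
    \int[mu]_(t in \big[setU/set0]_(i < n) I i) `|f t|.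
  rewrite {2}/Rintegral integral_bigsetU_EFin//.
  - rewrite sum_fine//= => i _; exact: (integrable_fin_num (mI i) (intnS _ (mI i))).
  - exact: index_enum_uniq.
  - by apply: sub_trivIset tab.
  - by case/integrableP: (intnS _ mU).
apply: Hd => //; rewrite measure_bigsetU_ord//.
apply: (@le_lt_trans _ _ (\sum_(i < n) (b i - a i))%:E); last by rewrite lte_fin.
rewrite -sumEFin; apply: lee_sum => i _; have [ai [abi bi]] := ab i.
have := lebesgue_measure_itv `]a i, b i[; rewrite /= lte_fin => ->.
by case: ltP => // H; rewrite lee_fin subr_ge0.
Qed.

Lemma primitive_is_derive : {ae mu, forall x : R, is_derive x 1 F (f x)}.
Proof.
have := @FTC1Ny R f.
have intfs y : mu.-integrable `]-oo, y] (EFin \o f).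
  by apply: integrableS intf => //; exact: measurable_itv.
have locf : locally_integrable [set: R] f.
  have := integrable_locally measurableT intf.
  by rewrite (_ : f \_ [set: R] = f)//; apply/funext => x; rewrite patchE in_setT.
move=> /(_ intfs locf);
apply: filterS; first exact: (ae_filter_ringOfSetsType mu).
move=> x [dF <-].
by rewrite derive1E; exact/derivableP.
Qed.

End PrimitiveAbsContinuous.

(** Subtracting from [f] the indefinite integral of [g] leaves an absolutely continuous function
    with derivative 0 almost everywhere, hence a constant. *)
Lemma abs_continuous01_FTC (R : realType) (f g : R -> R) :
  abs_continuous01 f -> lebesgue_measure.-integrable `[0, 1] (EFin \o g) ->
  {ae (@lebesgue_measure R), forall x : R, 0 < x < 1 -> is_derive x 1 f (g x)} ->
  forall a b : R, 0 <= a -> a <= b -> b <= 1 ->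
  \int[lebesgue_measure]_(x in `[a, b]) g x = f b - f a.
Proof.
move=> acf intg fg a b a0 ab b1.
(* Extension by zero, since the primitive integrates from minus infinity. *)
pose h := g \_ (`[0, 1] : set R).
have inth : lebesgue_measure.-integrable [set: R] (EFin \o h).
  rewrite /h -restrict_EFin; apply/integrable_restrict => //.
  by rewrite setTI.
have hg x : 0 <= x <= 1 -> h x = g x.
  by move=> x01; rewrite /h patchE mem_set//= in_itv.
pose F (x : R) : R := \int[lebesgue_measure]_(t in `]-oo, x]) h t.
have H : {ae (@lebesgue_measure R), forall x : R, 0 < x < 1 ->
    is_derive x 1 (fun y => f y - F y) 0}.
  have := primitive_is_derive inth; move: fg.
  apply: filterS2; first exact: (ae_filter_ringOfSetsType lebesgue_measure).
  move=> x fgx Fh x01.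
  rewrite -(subrr (g x)); apply: is_deriveB; first exact: fgx.
  by have := Fh; rewrite -/F hg//; lra.
have acF := abs_continuous01B acf (primitive_abs_continuous01 inth).
have E x : 0 <= x <= 1 -> f x - F x = f 0 - F 0.
  by move=> x01; exact: (abs_continuous01_derive0 acF H).
have -> : \int[lebesgue_measure]_(x in `[a, b]) g x =
    \int[lebesgue_measure]_(x in `]a, b]) h x.
  rewrite Rintegral_itv_obnd_cbnd; last first.
    by apply: integrableS inth => //; exact: measurable_itv.
  apply: eq_Rintegral => x; rewrite inE/= in_itv/= => xab.
  by rewrite hg//; lra.
rewrite -primitiveB//.
have := E a; have := E b; rewrite /F; lra.
Qed.

(** * Functions of the class W221 *)

Definition integrable01 (R : realType) (f : R -> R) : Prop :=
  lebesgue_measure.-integrable (`[0, 1] : set (measurableTypeR R)) (EFin \o f).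

Lemma integrable01S (R : realType) (f : R -> R) (a b : R) : integrable01 f ->
  0 <= a -> b <= 1 ->
  lebesgue_measure.-integrable (`[a, b] : set (measurableTypeR R)) (EFin \o f).
Proof.
move=> intf a0 b1; apply: integrableS intf => //; try exact: measurable_itv.
by move=> x /=; rewrite !in_itv/= => /andP[ax xb]; apply/andP; split; lra.
Qed.

Lemma integrable01_oo (R : realType) (f : R -> R) :
  lebesgue_measure.-integrable (`]0, 1[ : set (measurableTypeR R)) (EFin \o f) ->
  integrable01 f.
Proof.
move=> /integrableP[mf intf].
have mf1 : measurable_fun (`]0, 1] : set (measurableTypeR R)) (EFin \o f).
  exact/emeasurable_fun_itv_bndo_bndcP.
have mf2 : measurable_fun (`[0, 1] : set (measurableTypeR R)) (EFin \o f).
  exact/emeasurable_fun_itv_obnd_cbndP.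
apply/integrableP; split=> //.
rewrite -integral_itv_obnd_cbnd; last exact: measurableT_comp mf1.
by rewrite -integral_itv_bndo_bndc//; exact: measurableT_comp mf.
Qed.

Lemma Rintegral01_oo (R : realType) (f : R -> R) : integrable01 f ->
  \int[lebesgue_measure]_(x in `]0, 1[) f x =
  \int[lebesgue_measure]_(x in `[0, 1]) f x.
Proof.
move=> intf.
rewrite Rintegral_itv_bndo_bndc; last first.
  by apply: integrableS intf => //; exact: subset_itvW.
rewrite Rintegral_itv_obnd_cbnd//.
by apply: integrableS intf => //; exact: subset_itv_oc_cc.
Qed.

Lemma continuous_integrable01 (R : realType) (f : R -> R) :
  {within `[0, 1], continuous f} -> integrable01 f.
Proof.
by move=> cf; apply: continuous_compact_integrable => //; exact: segment_compact.
Qed.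

Lemma integrable01D (R : realType) (f g : R -> R) :
  integrable01 f -> integrable01 g -> integrable01 (fun x => f x + g x).
Proof. by move=> intf intg; exact: (integrableD _ intf intg). Qed.

Lemma integrable01B (R : realType) (f g : R -> R) :
  integrable01 f -> integrable01 g -> integrable01 (fun x => f x - g x).
Proof. by move=> intf intg; exact: (integrableB _ intf intg). Qed.

Lemma integrable01M (R : realType) (f g : R -> R) :
  {within `[0, 1], continuous f} -> integrable01 g ->
  integrable01 (fun x => f x * g x).
Proof.
move=> cf intg; have [B B0 fB] := within_continuous_bounded ler01 cf.
apply: (integrableMr _ _ _ intg) => //.
  by case/integrableP: (continuous_integrable01 cf) => /measurable_EFinP.
exists B; split; first exact: gtr0_real.
move=> y By x /=; rewrite in_itv/= => x01.
exact: le_trans (fB _ x01) (ltW By).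
Qed.

(** On a bounded interval [1 + f ^+ 2] is integrable, and it dominates the absolute value of [f]. *)
Lemma sqr_integrable01 (R : realType) (f : R -> R) :
  measurable_fun (`]0, 1[ : set (measurableTypeR R)) f ->
  integrable01 (fun x => f x ^+ 2) -> integrable01 f.
Proof.
move=> mf intf2; apply: integrable01_oo.
have int1 : integrable01 (fun x => 1 + f x ^+ 2).
  apply: integrable01D intf2; apply: continuous_integrable01.
  by apply: continuous_subspaceT => x; exact: cst_continuous.
have int2 : lebesgue_measure.-integrable (`]0, 1[ : set (measurableTypeR R))
    (EFin \o (fun x => 1 + f x ^+ 2)).
  by apply: integrableS int1 => //; exact: subset_itv_oo_cc.
apply: le_integrable int2 => //; first exact/measurable_EFinP.
move=> x _ /=; rewrite lee_fin; set y := f x.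
rewrite [leRHS]ger0_norm ?addr_ge0 ?sqr_ge0// ler_norml; nra.
Qed.

Lemma Rintegral_itv_cat (R : realType) (f : R -> R) (a b c : R) :
  a <= b -> b <= c ->
  lebesgue_measure.-integrable (`[a, c] : set (measurableTypeR R)) (EFin \o f) ->
  \int[lebesgue_measure]_(x in `[a, c]) f x =
  \int[lebesgue_measure]_(x in `[a, b]) f x +
  \int[lebesgue_measure]_(x in `[b, c]) f x.
Proof.
move=> ab bc intf; have := Rintegral_itvB intf (x := b).
rewrite !bnd_simp => /(_ ab bc) H.
rewrite -(Rintegral_itv_obnd_cbnd (r := b)); first by rewrite -H; ring.
apply: integrableS intf => //; try exact: measurable_itv.
by move=> x /=; rewrite !in_itv/= => /andP[? ?]; apply/andP; split; lra.
Qed.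

Lemma Rintegral_itv_sum (R : realType) (f : R -> R) (t : nat -> R) (n : nat) :
  {homo t : i j / (i <= j)%N >-> i <= j} ->
  lebesgue_measure.-integrable (`[t 0, t n] : set (measurableTypeR R)) (EFin \o f) ->
  \int[lebesgue_measure]_(x in `[t 0, t n]) f x =
  \sum_(i < n) \int[lebesgue_measure]_(x in `[t i, t i.+1]) f x.
Proof.
move=> tle; elim: n => [|n IH] intf.
  by rewrite big_ord0 set_itv1 Rintegral_set1.
rewrite big_ord_recr/= -IH; first by rewrite -Rintegral_itv_cat//; exact: tle.
apply: integrableS intf => //; try exact: measurable_itv.
move=> x /=; rewrite !in_itv/= => /andP[? ?]; apply/andP; split=> //.
by apply: le_trans (tle n n.+1 _).
Qed.

Lemma derivable01_within_continuous (R : realType) (f : R -> R) :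
  (forall x, 0 <= x <= 1 -> derivable01 f x) -> {within `[0, 1], continuous f}.
Proof.
move=> df; apply: within_continuous_dist => x x01 e e0.
have /diff_quot01_dist/(_ _ ltr01)[r r0 Hr] := df x x01.
set d := lim _ in Hr.
have p : 0 < `|d| + 1 by rewrite ltr_wpDl.
exists (Num.min r (e / (`|d| + 1))); first by rewrite lt_min r0 divr_gt0.
move=> y y01; rewrite lt_min ltr_pdivlMr// => /andP[yr ye].
apply: ltW; apply: le_lt_trans ye.
rewrite (_ : f y - f x = (f y - f x - d * (y - x)) + d * (y - x)); last by ring.
apply: le_trans (ler_normD _ _) _; rewrite normrM.
by have := Hr y y01 yr; set u := `|_ - _ - _|; rewrite mul1r; lra.
Qed.

Section SobolevFunction.
Variables (R : realType) (phi : R -> R).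
Hypothesis Wphi : W221 phi.
Local Notation mu := (@lebesgue_measure R).
Local Notation g := (deriv01 phi).
Let psi (x : R) : R := deriv01 g x + g x.

Lemma W221_within_continuous : {within `[0, 1], continuous phi}.
Proof. by case: Wphi => dphi _ _ _; exact: derivable01_within_continuous. Qed.

Lemma W221_deriv_within_continuous : {within `[0, 1], continuous g}.
Proof. by case: Wphi => _ acg _ _; exact: abs_continuous01_within. Qed.

Lemma W221_is_derive (x : R) : 0 < x < 1 -> is_derive x 1 phi (g x).
Proof.
case: Wphi => dphi _ _ _ x01; apply: derivable01_is_derive => //.
by apply: dphi; lra.
Qed.

(** The derivative is continuous, hence bounded, and the mean value theorem makes [phi] Lipschitz.
    The integration by parts uses this for the boundary term in [phi]. *)
Lemma W221_abs_continuous01 : abs_continuous01 phi.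
Proof.
have [B B0 gB] := within_continuous_bounded ler01 W221_deriv_within_continuous.
apply: (@lipschitz_abs_continuous01 _ _ B) => x y x0 xy y1.
have [c cxy ->] : exists2 c, c \in `[x, y] & phi y - phi x = g c * (y - x).
  apply: MVT_segment => //.
    by move=> z; rewrite in_itv/= => zxy; apply: W221_is_derive; lra.
  apply: continuous_subspaceW W221_within_continuous.
  by apply: subset_itv; rewrite bnd_simp.
rewrite normrM (ger0_norm (x := y - x)) ?subr_ge0//; apply: ler_wpM2r.
  by rewrite subr_ge0.
by apply: gB; move: cxy; rewrite in_itv/=; lra.
Qed.

Lemma W221_deriv2_integrable : integrable01 (deriv01 g).
Proof.
case: Wphi => _ _ _ [mf intf2]; apply: sqr_integrable01 => //.
exact: integrable01_oo.
Qed.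

Lemma W221_residual_integrable : integrable01 psi.
Proof.
apply: integrable01D; first exact: W221_deriv2_integrable.
by apply: continuous_integrable01; exact: W221_deriv_within_continuous.
Qed.

(** Expanding the square leaves the square of the second derivative and products with the bounded
    factor [g]. *)
Lemma W221_residual_sqr_integrable : integrable01 (fun x => psi x ^+ 2).
Proof.
case: Wphi => _ _ _ [mf intf2]; have cg := W221_deriv_within_continuous.
have int2 := integrable01M cg W221_deriv2_integrable.
have int3 := integrable01M cg (continuous_integrable01 cg).
have -> : (fun x => psi x ^+ 2) = (fun x => deriv01 g x ^+ 2 +
    ((g x * deriv01 g x + g x * deriv01 g x) + g x * g x)).
  by apply/funext => x; rewrite /psi; ring.
apply: integrable01D; first exact: integrable01_oo.
by apply: integrable01D int3; exact: integrable01D.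
Qed.

(* The antiderivative is k g - (x - m) phi, because k' - k = x - m. *)
Lemma W221_piece (a b c m : R) (k := fun x => c * expR x - (x - m) - 1) :
  0 <= a -> a <= b -> b <= 1 ->
  \int[mu]_(x in `[a, b]) phi x = \int[mu]_(x in `[a, b]) (k x * psi x) -
   (k b * g b - (b - m) * phi b) + (k a * g a - (a - m) * phi a).
Proof.
move=> a0 ab b1; case: (Wphi) => _ acg aeg _.
have dk (x : R) : is_derive x 1 k (c * expR x - 1).
  apply: is_derive_eq; rewrite /GRing.scale/=; ring.
have ck : {within `[0, 1], continuous k}.
  apply: continuous_subspaceT => x; apply: differentiable_continuous.
  by apply/derivable1_diffP; case: (dk x).
have dm (x : R) : is_derive x 1 (fun x => x - m) 1.
  apply: is_derive_eq; rewrite /GRing.scale/=; ring.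
have ack : abs_continuous01 k.
  apply: (@lipschitz_abs_continuous01 _ _ (`|c| * expR 1 + 1)) => x y x0 xy y1.
  have [z zxy ->] : exists2 z, z \in `[x, y] & k y - k x = (c * expR z - 1) * (y - x).
    apply: MVT_segment => //.
    by apply: continuous_subspaceW ck; apply: subset_itv; rewrite bnd_simp.
  rewrite normrM (ger0_norm (x := y - x)) ?subr_ge0//; apply: ler_wpM2r.
    by rewrite subr_ge0.
  apply: le_trans (ler_normB _ _) _; rewrite normr1 lerD2r normrM.
  rewrite (ger0_norm (expR_ge0 _)); apply: ler_wpM2l => //.
  by rewrite ler_expR; move: zxy; rewrite in_itv/=; lra.
have acm : abs_continuous01 (fun x : R => x - m).
  apply: (@lipschitz_abs_continuous01 _ _ 1) => x y x0 xy y1.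
  rewrite (_ : _ - _ = y - x); last by ring.
  by rewrite mul1r ger0_norm ?subr_ge0.
have acF := abs_continuous01B (abs_continuous01M ack acg)
  (abs_continuous01M acm W221_abs_continuous01).
have intk : integrable01 (fun x => k x * psi x).
  exact: integrable01M W221_residual_integrable.
have intphi : integrable01 phi.
  exact: continuous_integrable01 W221_within_continuous.
have aeF : {ae mu, forall x : R, 0 < x < 1 ->
    is_derive x 1 (fun x => k x * g x - (x - m) * phi x) (k x * psi x - phi x)}.
  move: aeg; apply: filterS; first exact: (ae_filter_ringOfSetsType mu).
  move=> x gx x01; have dg := derivable01_is_derive x01 (gx x01).
  have dphi := W221_is_derive x01.
  have := is_deriveB (is_deriveM (dk x) dg) (is_deriveM (dm x) dphi).
  move=> /is_derive_eq; apply.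
  by rewrite /psi /k /GRing.scale/=; ring.
have := abs_continuous01_FTC acF (integrable01B intk intphi) aeF a0 ab b1.
rewrite RintegralB//; [lra|exact: integrable01S|exact: integrable01S].
Qed.

End SobolevFunction.

(** * The kernel of the error functional *)

Definition node (R : realType) (N i : nat) : R := step R N * i%:R.

(* The jump [c_i e^(t_i) - c_(i-1) e^(t_i) + h] of the kernel at [t_i] has to be
   [C1 i]; solving this recurrence gives the sum below. *)
Definition kernel_coef (R : realType) (N : nat) (C1 : 'I_N.+1 -> R) (i : nat) : R :=
  1 + step R N / 2 + \sum_(j < i.+1) (C1 (inord j) - step R N) * expR (- node R N j).

(** Centring at the midpoint gives both end values of [phi] on a piece the weight [step R N / 2],
    which produces the prescribed [C0]. *)
Definition kernel (R : realType) (N : nat) (C1 : 'I_N.+1 -> R) (i : nat) (x : R) : R :=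
  kernel_coef C1 i * expR x - (x - (node R N i + step R N / 2)) - 1.

(** The L2 inner product on [0, 1]. The index lets a function have two values at a node, as a kernel
    with jumps does. *)
Definition pairing (R : realType) (N : nat) (u v : nat -> R -> R) : R :=
  \sum_(i < N) \int[lebesgue_measure]_(x in `[node R N i, node R N i.+1])
    (u i x * v i x).

Lemma step_gt0 (R : realType) (N : nat) : (0 < N)%N -> 0 < step R N.
Proof. by move=> N0; rewrite invr_gt0 ltr0n. Qed.

Lemma node_le (R : realType) (N : nat) :
  {homo node R N : i j / (i <= j)%N >-> i <= j}.
Proof. by move=> i j ij; rewrite ler_wpM2l ?invr_ge0 ?ler0n// ler_nat. Qed.

Lemma node0 (R : realType) (N : nat) : node R N 0 = 0.
Proof. by rewrite /node mulr0. Qed.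

Lemma nodeN (R : realType) (N : nat) : (0 < N)%N -> node R N N = 1.
Proof. by move=> N0; rewrite /node /step mulVf// pnatr_eq0 -lt0n. Qed.

Lemma nodeS (R : realType) (N i : nat) : node R N i.+1 = node R N i + step R N.
Proof. by rewrite /node -natr1 mulrDr mulr1. Qed.

Lemma node_ge0 (R : realType) (N i : nat) : 0 <= node R N i.
Proof. by rewrite -(node0 R N) node_le. Qed.

Lemma node_le1 (R : realType) (N i : nat) : (0 < N)%N -> (i <= N)%N -> node R N i <= 1.
Proof. by move=> N0 iN; rewrite -(nodeN R N0) node_le. Qed.

(** The constant [1 + step R N / 2] in [kernel_coef] is chosen for this: with 0 to the left of the
    first node, the jump there is [C1 ord0]. *)
Lemma kernel0 (R : realType) (N : nat) (C1 : 'I_N.+1 -> R) :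
  kernel C1 0 (node R N 0) = C1 ord0.
Proof.
rewrite /kernel /kernel_coef big_ord_recl big_ord0 node0 oppr0 expR0.
rewrite (_ : inord _ = ord0); last by apply: val_inj; rewrite /= inordK.
by rewrite /=; field.
Qed.

(** The new term of the coefficient contributes [C1 - step] at the node, and the shift of the
    midpoint gives the step back. *)
Lemma kernelS (R : realType) (N : nat) (C1 : 'I_N.+1 -> R) (i : nat) :
  kernel C1 i.+1 (node R N i.+1) = kernel C1 i (node R N i.+1) + C1 (inord i.+1).
Proof.
rewrite /kernel /kernel_coef [in LHS]big_ord_recr /= expRN nodeS.
have := expR_gt0 (node R N i + step R N); set E := expR _ => E0.
by field; rewrite gt_eqF.
Qed.

(** An interior node receives half a step from each of its two pieces, an end node from one piece
    only. *)
Lemma trapezoid_sum (R : realType) (n : nat) (u : nat -> R) :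
  \sum_(b < n.+2) C0 R b * u b =
  \sum_(i < n.+1) step R n.+1 / 2 * (u i + u i.+1).
Proof.
have -> : \sum_(b < n.+2) C0 R b * u b =
    step R n.+1 / 2 * u 0 + (\sum_(i < n) step R n.+1 * u i.+1 +
    step R n.+1 / 2 * u n.+1).
  rewrite big_ord_recl /C0 eqxx /= big_ord_recr /=; congr (_ + (_ + _)).
    apply: eq_bigr => i _; rewrite -[X in (if X then _ else _)]val_eqE /=.
    by rewrite /bump /= add1n ltn_eqF// ltnS.
  by rewrite -val_eqE /= /bump /= add1n eqxx.
rewrite -!mulr_sumr big_split/= big_ord_recl /= [in RHS]big_ord_recr /=.
set S := \sum_(i < n) u i.+1.
by field.
Qed.

(** Summation by parts: at every node but the last the two boundary terms combine to the jump of the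
    kernel. *)
Lemma kernel_boundary_sum (R : realType) (N : nat) (C1 : 'I_N.+1 -> R)
    (u : nat -> R) (n : nat) :
  \sum_(i < n.+1) (kernel C1 i (node R N i.+1) * u i.+1 -
                   kernel C1 i (node R N i) * u i) =
  kernel C1 n (node R N n.+1) * u n.+1 - \sum_(i < n.+1) C1 (inord i) * u i.
Proof.
elim: n => [|n IH].
  rewrite !big_ord_recl !big_ord0 /= kernel0 (_ : inord _ = ord0) ?addr0//.
  by apply: val_inj; rewrite /= inordK.
by rewrite big_ord_recr IH [in RHS]big_ord_recr /= kernelS; ring.
Qed.

(** Admissibility is not assumed here: the last term is the defect at 1, from which [admissibleP]
    reads off the constraint. *)
Lemma error_functionalE (R : realType) (N : nat) (C1 : 'I_N.+1 -> R)
    (phi : R -> R) : (0 < N)%N -> W221 phi ->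
  error_functional C1 phi =
  pairing N (kernel C1) (fun _ x => deriv01 (deriv01 phi) x + deriv01 phi x) -
  (kernel C1 N.-1 1 + C1 ord_max) * deriv01 phi 1.
Proof.
case: N C1 => // n C1 _ Wphi; rewrite /error_functional.
have intphi : integrable01 phi.
  exact: continuous_integrable01 (W221_within_continuous Wphi).
have /= := @Rintegral_itv_sum _ phi (node R n.+1) n.+1 (@node_le _ _).
rewrite node0 nodeN// => /(_ intphi) ->.
rewrite (eq_bigr (fun i : 'I_n.+1 => (
  \int[lebesgue_measure]_(x in `[node R n.+1 i, node R n.+1 i.+1])
    (kernel C1 i x * (deriv01 (deriv01 phi) x + deriv01 phi x)) +
  step R n.+1 / 2 * (phi (node R n.+1 i) + phi (node R n.+1 i.+1))) -
  (kernel C1 i (node R n.+1 i.+1) * deriv01 phi (node R n.+1 i.+1) -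
   kernel C1 i (node R n.+1 i) * deriv01 phi (node R n.+1 i)))); last first.
  move=> i _; rewrite (W221_piece Wphi (kernel_coef C1 i)
    (node R n.+1 i + step R n.+1 / 2)); last 3 first.
  - exact: node_ge0.
  - exact: node_le.
  - exact: node_le1.
  by rewrite -/(kernel C1 i _) nodeS /kernel; field.
rewrite sumrB big_split /=.
rewrite (kernel_boundary_sum C1 (fun i => deriv01 phi (node R n.+1 i))).
rewrite -(trapezoid_sum n (fun i => phi (node R n.+1 i))).
rewrite big_split/= /pairing nodeN//.
rewrite [X in _ - (_ + X)]big_ord_recr /= -/(node R n.+1 n.+1) nodeN//.
have -> : \sum_(i < n.+1) C1 (inord i) * deriv01 phi (node R n.+1 i) =
    \sum_(i < n.+1) C1 (widen_ord (leqnSn n.+1) i) *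
      deriv01 phi (step R n.+1 * i%:R).
  apply: eq_bigr => i _; congr (C1 _ * _); apply: val_inj.
  by rewrite /= inordK// ltnW// ltnS.
by rewrite /node; ring.
Qed.

(** * Test functions with prescribed residual, and admissibility *)

Lemma smooth_W221 (R : realType) (phi g psi : R -> R) :
  (forall x : R, 0 <= x <= 1 -> is_derive x 1 phi (g x)) ->
  (forall x : R, 0 <= x <= 1 -> is_derive x 1 g (psi x - g x)) ->
  {within `[0, 1], continuous psi} ->
  W221 phi /\ forall x, 0 <= x <= 1 ->
    deriv01 phi x = g x /\ deriv01 (deriv01 phi) x + deriv01 phi x = psi x.
Proof.
move=> dphi dg cpsi.
have phi1 x : 0 <= x <= 1 -> derivable01 phi x /\ deriv01 phi x = g x.
  by move=> x01; apply: deriv01_cvg => //; exact/is_derive_diff_quot01/dphi.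
have phi2 x : 0 <= x <= 1 ->
    derivable01 (deriv01 phi) x /\ deriv01 (deriv01 phi) x = psi x - g x.
  move=> x01; apply: deriv01_cvg => //.
  apply: cvg_trans (is_derive_diff_quot01 (dg _ x01)).
  by apply: eq_diff_quot01 => // y y01; case: (phi1 y y01).
have cg : {within `[0, 1], continuous g}.
  apply: derivable01_within_continuous => x x01; apply/cvg_ex.
  by exists (psi x - g x); exact/is_derive_diff_quot01/dg.
have cpg : {within `[0, 1], continuous (fun x => psi x - g x)}.
  by move=> x; apply: cvgB; [exact: cpsi|exact: cg].
split; last first.
  move=> x x01; have [_ ->] := phi1 x x01; have [_ ->] := phi2 x x01.
  by rewrite subrK.
split.
- by move=> x /phi1[].
- have [B B0 dgB] := within_continuous_bounded ler01 cpg.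
  apply: (@lipschitz_abs_continuous01 _ _ B) => x y x0 xy y1.
  have [_ ->] : derivable01 phi x /\ deriv01 phi x = g x by apply: phi1; lra.
  have [_ ->] : derivable01 phi y /\ deriv01 phi y = g y by apply: phi1; lra.
  have [c cxy ->] : exists2 c, c \in `[x, y] & g y - g x = (psi c - g c) * (y - x).
    apply: MVT_segment => //.
      by move=> z; rewrite in_itv/= => zxy; apply: dg; lra.
    by apply: continuous_subspaceW cg; apply: subset_itv; rewrite bnd_simp.
  rewrite normrM (ger0_norm (x := y - x)) ?subr_ge0//; apply: ler_wpM2r.
    by rewrite subr_ge0.
  by apply: dgB; move: cxy; rewrite in_itv/=; lra.
- apply: aeW => x x01; have [] := phi2 x => //; lra.
- have E (x : R) : `]0, 1[%classic x -> psi x - g x = deriv01 (deriv01 phi) x.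
    by rewrite /= in_itv/= => x01; have [] := phi2 x => //; lra.
  have intpg := continuous_integrable01 cpg.
  split.
    apply: (eq_measurable_fun (fun x => psi x - g x)).
      by move=> x; rewrite inE; exact: E.
    case/integrableP: intpg => /measurable_EFinP + _; apply: measurable_funS => //.
    exact: subset_itv_oo_cc.
  have int2 := integrable01M cpg intpg.
  have {}int2 : lebesgue_measure.-integrable (`]0, 1[ : set (measurableTypeR R))
      (EFin \o (fun x => (psi x - g x) * (psi x - g x))).
    by apply: integrableS int2 => //; exact: subset_itv_oo_cc.
  apply: eq_integrable int2 => // x; rewrite inE => /E /= <-.
  by rewrite expr2.
Qed.

(** Variation of constants: [g] solves g' + g = psi with integrating factor e^x, and subtracting it
    from a primitive of [psi] gives a primitive of [g]. *)
Lemma W221_test (R : realType) (psi : R -> R) : continuous psi ->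
  exists2 phi, W221 phi & forall x, 0 <= x <= 1 ->
    deriv01 (deriv01 phi) x + deriv01 phi x = psi x.
Proof.
move=> cpsi.
have prim (f : R -> R) : continuous f ->
    exists F : R -> R, forall x : R, 0 <= x <= 1 -> is_derive x 1 F (f x).
  (* Starting at -1 and working in [-1, 2] puts 0 and 1 in the interior, so the derivatives there
     are two-sided. *)
  move=> cf; exists (fun x => \int[lebesgue_measure]_(t in `[-1, x]) f t).
  move=> x x01.
  have intf : lebesgue_measure.-integrable (`[-1, 2] : set (measurableTypeR R))
      (EFin \o f).
    apply: continuous_compact_integrable; first exact: segment_compact.
    exact: continuous_subspaceT.
  have [||//|dF <-] := continuous_FTC1_closed (x := x) _ intf; try lra.
    exact: cf.
  by rewrite derive1E; exact/derivableP.
have [J dJ] := prim _ cpsi.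
have [|I dI] := prim (fun x => expR x * psi x).
  by move=> x; apply: cvgM; [exact: continuous_expR|exact: cpsi].
pose g x := expR (- x) * I x.
have dE (x : R) : is_derive x 1 (fun x => expR (- x)) (- expR (- x)).
  by apply: is_derive_eq; rewrite /GRing.scale/=; ring.
have dg (x : R) : 0 <= x <= 1 -> is_derive x 1 g (psi x - g x).
  move=> x01; have := is_deriveM (dE x) (dI x x01).
  move=> /is_derive_eq; apply; rewrite /GRing.scale/= /g mulrA -expRD addNr expR0.
  ring.
have dphi (x : R) : 0 <= x <= 1 -> is_derive x 1 (fun x => J x - g x) (g x).
  move=> x01; have := is_deriveB (dJ x x01) (dg x x01).
  by move=> /is_derive_eq; apply; ring.
have [|W D] := smooth_W221 dphi dg; first exact: continuous_subspaceT.
by exists (fun x => J x - g x) => // x /D[].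
Qed.

(** The residual of e^(-x) is 0, so only the defect at 1 remains, multiplied by the nonzero
    derivative of e^(-x) there. *)
Lemma admissibleP (R : realType) (N : nat) (C1 : 'I_N.+1 -> R) : (0 < N)%N ->
  admissible C1 <-> kernel C1 N.-1 1 + C1 ord_max = 0.
Proof.
move=> N0.
have dphi (x : R) : is_derive x 1 (fun x => expR (- x)) (- expR (- x)).
  by apply: is_derive_eq; rewrite /GRing.scale/=; ring.
have dg (x : R) : is_derive x 1 (fun x => - expR (- x)) (0 - - expR (- x)).
  by apply: is_derive_eq; rewrite /GRing.scale/=; ring.
have c0 : {within `[0, 1], continuous (fun _ : R => 0 : R)}.
  by apply: continuous_subspaceT => x; exact: cst_continuous.
have [W D] := smooth_W221 (psi := fun _ : R => 0) (fun x _ => dphi x)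
  (fun x _ => dg x) c0.
rewrite /admissible error_functionalE//.
have [-> _] : _ /\ _ := D 1 (introT andP (conj ler01 (lexx 1))).
rewrite /pairing big1 ?sub0r; last first.
  move=> i _.
  rewrite (@eq_Rintegral _ _ _ _ _ (fun=> 0)).
    by rewrite Rintegral_cst// mul0r.
  move=> x; rewrite inE/= in_itv/= => /andP[ix xi].
  have x01 : 0 <= x <= 1.
    by rewrite (le_trans (node_ge0 _ _ _) ix) (le_trans xi)// node_le1.
  by have [_ ->] := D x x01; rewrite mulr0.
rewrite mulrN opprK; split=> [/eqP|->]; last by rewrite mul0r.
by rewrite mulf_eq0 (gt_eqF (expR_gt0 _)) orbF => /eqP.
Qed.

(** Serves both Cauchy-Schwarz and the first-order argument in [quadratic_le_eq]. *)
Lemma discriminant_le (R : realType) (A B C : R) : 0 <= C ->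
  (forall s : R, 0 <= A - 2 * s * B + s ^+ 2 * C) -> B ^+ 2 <= C * A.
Proof.
rewrite le_eqVlt => /predU1P[<-|C0] H.
  rewrite mul0r; have [->|B0] := eqVneq B 0; first by rewrite expr0n.
  (* When [C] is 0 the expression is affine in [s], and this [s] would give it the value -1. *)
  have := H ((A + 1) / (2 * B)); rewrite mulr0 addr0.
  rewrite (_ : 2 * _ * B = A + 1); [lra|by field].
(* The vertex of the parabola. *)
have := H (B / C).
rewrite (_ : A - _ + _ = (C * A - B ^+ 2) / C); last by field; rewrite gt_eqF.
by rewrite pmulr_lge0 ?invr_gt0// subr_ge0.
Qed.

(** * The pairing as a positive semidefinite bilinear form *)

Section Pairing.
Variables (R : realType) (N : nat).
Local Notation mu := (@lebesgue_measure R).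
Local Notation piece i :=
  (`[node R N i, node R N i.+1]%classic : set (measurableTypeR R)).
Implicit Types u v w : nat -> R -> R.

Definition pairing_integrable u v : Prop := forall i, (i < N)%N ->
  mu.-integrable (piece i) (EFin \o (fun x => u i x * v i x)).

Lemma pairingC u v : pairing N u v = pairing N v u.
Proof.
by apply: eq_bigr => i _; apply: eq_Rintegral => x _; rewrite mulrC.
Qed.

Lemma pairing_ge0 u : 0 <= pairing N u u.
Proof.
by apply: sumr_ge0 => i _; apply: Rintegral_ge0 => x _; rewrite -expr2 sqr_ge0.
Qed.

Lemma pairing_lin (a b : R) u v w :
  pairing_integrable u w -> pairing_integrable v w ->
  pairing N (fun i x => a * u i x + b * v i x) w =
  a * pairing N u w + b * pairing N v w.
Proof.
move=> iuw ivw; rewrite /pairing !mulr_sumr -big_split; apply: eq_bigr => i _ /=.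
have mi : measurable (piece i) by exact: measurable_itv.
have iu := iuw i (ltn_ord i); have iv := ivw i (ltn_ord i).
rewrite -!RintegralZl// -RintegralD//.
- by apply: eq_Rintegral => x _; ring.
- exact: (integrableZl mi a iu).
- exact: (integrableZl mi b iv).
Qed.

Lemma pairing_integrable_lin (a b : R) u v w :
  pairing_integrable u w -> pairing_integrable v w ->
  pairing_integrable (fun i x => a * u i x + b * v i x) w.
Proof.
move=> iuw ivw i iN; have mi : measurable (piece i) by exact: measurable_itv.
have := integrableD mi (integrableZl mi a (iuw i iN)) (integrableZl mi b (ivw i iN)).
apply: eq_integrable => // x _ /=; rewrite -EFinD; congr EFin; ring.
Qed.

Lemma pairing_integrableC u v : pairing_integrable u v -> pairing_integrable v u.
Proof.
move=> iuv i iN; apply: eq_integrable (iuv i iN) => //; try exact: measurable_itv.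
by move=> x _ /=; rewrite mulrC.
Qed.

Lemma pairing_continuous u v : (forall i, continuous (u i)) ->
  (forall i, continuous (v i)) -> pairing_integrable u v.
Proof.
move=> cu cv i _; apply: continuous_compact_integrable; first exact: segment_compact.
apply: continuous_subspaceT => x; apply: cvgM; [exact: cu|exact: cv].
Qed.

Lemma pairing_sqr_lin (s : R) u v :
  pairing_integrable u u -> pairing_integrable u v -> pairing_integrable v v ->
  pairing N (fun i x => 1 * v i x + s * u i x) (fun i x => 1 * v i x + s * u i x) =
  pairing N v v + 2 * s * pairing N u v + s ^+ 2 * pairing N u u.
Proof.
move=> iuu iuv ivv; have ivu := pairing_integrableC iuv.
have i1 := pairing_integrableC (pairing_integrable_lin 1 s ivv iuv).
have i2 := pairing_integrableC (pairing_integrable_lin 1 s ivu iuu).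
rewrite pairing_lin// ![pairing _ _ (fun _ _ => _ + _)]pairingC !pairing_lin//.
rewrite (pairingC v u); ring.
Qed.

Lemma pairing_CauchySchwarz u v :
  pairing_integrable u u -> pairing_integrable u v -> pairing_integrable v v ->
  pairing N u v ^+ 2 <= pairing N u u * pairing N v v.
Proof.
move=> iuu iuv ivv; apply: discriminant_le => [|s]; first exact: pairing_ge0.
have := pairing_sqr_lin (- s) iuu iuv ivv.
rewrite sqrrN mulrN mulNr => <-; exact: pairing_ge0.
Qed.

Lemma eq_pairing u u' v v' : (0 < N)%N ->
  (forall i x, (i < N)%N -> node R N i <= x <= node R N i.+1 ->
     u i x * v i x = u' i x * v' i x) ->
  pairing N u v = pairing N u' v'.
Proof.
move=> N0 H; apply: eq_bigr => i _; apply: eq_Rintegral => x.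
by rewrite inE/= in_itv/=; exact: H.
Qed.

Lemma piece01 i x : (i < N)%N -> node R N i <= x <= node R N i.+1 -> 0 <= x <= 1.
Proof.
move=> iN /andP[ix xi]; have N0 : (0 < N)%N by exact: leq_ltn_trans iN.
by rewrite (le_trans (node_ge0 _ _ _) ix) (le_trans xi)// node_le1.
Qed.

Lemma W221_seminorm_sqr (phi : R -> R) (psi := fun (_ : nat) x =>
    deriv01 (deriv01 phi) x + deriv01 phi x) : (0 < N)%N -> W221 phi ->
  W221_seminorm phi ^+ 2 = pairing N psi psi.
Proof.
move=> N0 W; have int2 := W221_residual_sqr_integrable W.
rewrite sqr_sqrtr; last by apply: Rintegral_ge0 => x _; exact: sqr_ge0.
rewrite Rintegral01_oo//; have := Rintegral_itv_sum (n := N) (@node_le R N).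
rewrite node0 nodeN// => /(_ _ int2) ->.
by apply: eq_bigr => i _; apply: eq_Rintegral => x _; rewrite expr2.
Qed.

End Pairing.

(** * Bounds on the dual norm in terms of the kernel *)

Lemma continuous_kernel (R : realType) (N : nat) (C1 : 'I_N.+1 -> R) (i : nat) :
  continuous (kernel C1 i).
Proof.
move=> x; apply: differentiable_continuous; apply/derivable1_diffP.
apply: ex_derive.
Qed.

Lemma error_functional_pairing (R : realType) (N : nat) (C1 : 'I_N.+1 -> R)
    (phi : R -> R) : (0 < N)%N -> admissible C1 -> W221 phi ->
  error_functional C1 phi =
  pairing N (kernel C1) (fun _ x => deriv01 (deriv01 phi) x + deriv01 phi x).
Proof.
by move=> N0 /(admissibleP _ N0) C1E W; rewrite error_functionalE// C1E mul0r subr0.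
Qed.

(** Cauchy-Schwarz between the kernel and a residual of norm 1. *)
Lemma W221_dual_norm_le (R : realType) (N : nat) (C1 : 'I_N.+1 -> R) :
  (0 < N)%N -> admissible C1 ->
  (W221_dual_norm (error_functional C1) <=
   (Num.sqrt (pairing N (kernel C1) (kernel C1)))%:E)%E.
Proof.
move=> N0 adm; apply: ge_ereal_sup => _ [phi [W phi1] <-].
rewrite lee_fin -sqrtr_sqr ler_wsqrtr//.
rewrite (error_functional_pairing N0 adm W).
rewrite -[leRHS]mulr1 -(expr1n _ 2) -phi1 (W221_seminorm_sqr N0 W).
have ipsi := W221_residual_integrable W.
apply: pairing_CauchySchwarz => i iN.
- by apply: pairing_continuous iN => ?; exact: continuous_kernel.
- apply: integrable01S; [|exact: node_ge0|exact: node_le1].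
  by apply: integrable01M ipsi; apply: continuous_subspaceT; exact: continuous_kernel.
- apply: integrable01S; [|exact: node_ge0|exact: node_le1].
  exact: W221_residual_sqr_integrable W.
Qed.

(** After division by its norm, [psi] is the residual of some [phi] of semi-norm 1, whose error the
    dual norm bounds. The homogeneous form also covers [psi] of norm 0. *)
Lemma W221_dual_norm_test (R : realType) (N : nat) (C1 : 'I_N.+1 -> R) (M : R)
    (psi : R -> R) : (0 < N)%N -> admissible C1 -> 0 <= M ->
  (W221_dual_norm (error_functional C1) <= (Num.sqrt M)%:E)%E ->
  continuous psi ->
  pairing N (kernel C1) (fun=> psi) ^+ 2 <= M * pairing N (fun=> psi) (fun=> psi).
Proof.
move=> N0 adm M0 normM cpsi; set A := pairing N (fun=> psi) _.
have cpsi' (i : nat) : continuous psi by [].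
have ck i : continuous (kernel C1 i) by exact: continuous_kernel.
have := pairing_ge0 N (fun=> psi); rewrite -/A le_eqVlt => /predU1P[A0|A0].
  (* Here [psi] cannot be normalized, but its pairing with the kernel vanishes. *)
  have := pairing_CauchySchwarz (pairing_continuous (N := N) ck ck)
    (pairing_continuous ck cpsi') (pairing_continuous cpsi' cpsi').
  by rewrite -/A -A0 !mulr0.
pose s := Num.sqrt A; have s0 : 0 < s by rewrite sqrtr_gt0.
have s2 : s ^+ 2 = A by rewrite sqr_sqrtr// ltW.
have cs : continuous (fun x => s^-1 * psi x).
  by move=> x; apply: cvgM; [exact: cvg_cst|exact: cpsi].
have [phi W phiE] := W221_test cs.
have phi1 : W221_seminorm phi = 1.
  rewrite -[LHS]ger0_norm ?sqrtr_ge0// -sqrtr_sqr -[RHS]sqrtr1; congr Num.sqrt.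
  rewrite (W221_seminorm_sqr N0 W).
  (* The zero summand brings the scaled function into the shape of [pairing_lin]. *)
  transitivity (pairing N (fun _ x => s^-1 * psi x + 0 * psi x)
    (fun _ x => s^-1 * psi x + 0 * psi x)).
    apply: eq_pairing => // i x iN xi; rewrite phiE ?mul0r ?addr0//.
    exact: piece01 xi.
  have ic := pairing_continuous (N := N) cpsi' cpsi'.
  have ic2 := pairing_integrableC (pairing_integrable_lin (s^-1) 0 ic ic).
  rewrite pairing_lin// pairingC pairing_lin// -/A mul0r !addr0 -s2.
  by field; rewrite gt_eqF.
have lE : error_functional C1 phi = s^-1 * pairing N (kernel C1) (fun=> psi).
  rewrite (error_functional_pairing N0 adm W).
  transitivity (pairing N (fun _ x => s^-1 * psi x + 0 * psi x) (kernel C1)).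
    apply: eq_pairing => // i x iN xi; rewrite phiE ?mul0r ?addr0 1?mulrC//.
    exact: piece01 xi.
  have ic := pairing_continuous (N := N) cpsi' ck.
  by rewrite pairing_lin// mul0r addr0 pairingC.
have : `|error_functional C1 phi| <= Num.sqrt M.
  rewrite -lee_fin; apply: le_trans normM; apply: ereal_sup_ubound.
  by exists phi.
rewrite -sqrtr_sqr ler_sqrt// lE exprMn exprVn s2 mulrC ler_pdivrMr//.
Qed.

(** * The optimal kernel *)

(** The common value of c_i e^(t_i) for the optimal kernel. It equalizes the values at the two ends
    of a piece, and also makes the piece orthogonal to e^x. *)
Definition opt_scale (R : realType) (N : nat) : R := step R N / (expR (step R N) - 1).

Definition opt_kernel (R : realType) (N i : nat) (x : R) : R :=
  opt_scale R N * expR (x - node R N i) - (x - node R N i) + step R N / 2 - 1.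

Definition opt_coef0 (R : realType) (N : nat) : R :=
  step R N * (expR (step R N) + 1) / (2 * (expR (step R N) - 1)) - 1.

Lemma expR_step_gt1 (R : realType) (N : nat) : (0 < N)%N -> 1 < expR (step R N).
Proof. by move=> N0; rewrite expR_gt1 step_gt0. Qed.

(** On each piece all kernels solve the same linear equation k' - k = x - m_i, so two of them differ
    by a multiple of e^x. *)
Lemma kernelE (R : realType) (N : nat) (C1 : 'I_N.+1 -> R) (i : nat) (x : R) :
  kernel C1 i x = 1 * opt_kernel N i x +
    (kernel_coef C1 i - opt_scale R N * expR (- node R N i)) * expR x.
Proof. by rewrite /kernel /opt_kernel expRD; ring. Qed.

Lemma opt_kernel_node (R : realType) (N i : nat) :
  opt_kernel N i (node R N i) = opt_scale R N + step R N / 2 - 1.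
Proof. by rewrite /opt_kernel subrr expR0; ring. Qed.

Lemma opt_kernel_nodeS (R : realType) (N i : nat) : (0 < N)%N ->
  opt_kernel N i (node R N i.+1) = opt_scale R N + step R N / 2 - 1.
Proof.
move=> N0; rewrite /opt_kernel nodeS (addrC (node R N i)) addrK /opt_scale.
have := expR_step_gt1 R N0; set E := expR _ => E1.
by field; rewrite gt_eqF// subr_gt0.
Qed.

Lemma opt_kernel1 (R : realType) (N : nat) : (0 < N)%N ->
  opt_kernel N N.-1 1 = opt_scale R N + step R N / 2 - 1.
Proof. by move=> N0; rewrite -(@opt_kernel_nodeS _ _ N.-1)// prednK// nodeN. Qed.

Lemma opt_coef0E (R : realType) (N : nat) : (0 < N)%N ->
  opt_coef0 R N = opt_scale R N + step R N / 2 - 1.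
Proof.
move=> N0; rewrite /opt_coef0 /opt_scale.
have := expR_step_gt1 R N0; set E := expR _ => E1.
by field; rewrite gt_eqF// subr_gt0.
Qed.

Lemma kernel_opt (R : realType) (N : nat) (C1 : 'I_N.+1 -> R) (i : nat) (x : R) :
  kernel_coef C1 i = opt_scale R N * expR (- node R N i) ->
  kernel C1 i x = opt_kernel N i x.
Proof. by move=> C1E; rewrite kernelE C1E subrr mul0r addr0 mul1r. Qed.

(** A zero jump turns c_i into c_i - h e^(-t_(i+1)), and [opt_scale] s satisfies s e^h - h = s, so
    c_i e^(t_i) does not change. *)
Lemma opt_coefs_kernel (R : realType) (N : nat) (C1 : 'I_N.+1 -> R) :
  (0 < N)%N -> C1 ord0 = opt_coef0 R N ->
  (forall b : 'I_N.+1, (1 <= b <= N.-1)%N -> C1 b = 0) ->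
  forall i, (i < N)%N -> kernel_coef C1 i = opt_scale R N * expR (- node R N i).
Proof.
move=> N0 C10 C1b; elim=> [|i IH] iN.
  rewrite /kernel_coef big_ord_recl big_ord0 node0 oppr0 expR0 /=.
  rewrite (_ : inord _ = ord0); last by apply: val_inj; rewrite /= inordK.
  by rewrite C10 opt_coef0E//; field.
have := IH (ltnW iN); rewrite /kernel_coef => E.
rewrite big_ord_recr /= addrA E C1b; last first.
  rewrite inordK; last exact: ltnW.
  by apply/andP; split=> //; rewrite -ltnS prednK.
rewrite nodeS opprD [X in _ = _ * X]expRD [X in _ + _ * X]expRD expRN.
rewrite expRN /opt_scale.
have := expR_step_gt1 R N0; set e := expR _ => e1.
field; apply/and3P; split; rewrite gt_eqF//; try exact: expR_gt0; lra.
Qed.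

Lemma opt_coefs_admissible (R : realType) (N : nat) (C1 : 'I_N.+1 -> R) :
  (0 < N)%N -> C1 ord_max = - opt_coef0 R N ->
  (forall i, (i < N)%N -> kernel_coef C1 i = opt_scale R N * expR (- node R N i)) ->
  admissible C1.
Proof.
move=> N0 C1N C1E; apply/admissibleP => //.
rewrite kernel_opt; last by apply: C1E; rewrite prednK.
by rewrite opt_kernel1// C1N opt_coef0E// subrr.
Qed.

(** The coefficients are read off as jumps: from 0 to the common node value at 0, none inside, and
    back to 0 at 1. *)
Lemma kernel_opt_coefs (R : realType) (N : nat) (C1 : 'I_N.+1 -> R) :
  (0 < N)%N -> admissible C1 ->
  (forall i, (i < N)%N -> kernel_coef C1 i = opt_scale R N * expR (- node R N i)) ->
  [/\ C1 ord0 = opt_coef0 R N,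
      forall b : 'I_N.+1, (1 <= b <= N.-1)%N -> C1 b = 0
    & C1 ord_max = - opt_coef0 R N].
Proof.
move=> N0 adm C1E; split.
- by rewrite -kernel0 kernel_opt ?opt_kernel_node ?opt_coef0E//; exact: C1E.
- case=> -[//|b] bN /=; rewrite -ltnS prednK// => bN'.
  have := kernelS C1 b; rewrite !kernel_opt; [|exact/C1E/ltnW|exact: C1E].
  rewrite opt_kernel_node opt_kernel_nodeS// => /eqP.
  rewrite -subr_eq0 opprD addrA subrr sub0r oppr_eq0 => /eqP <-.
  by congr (C1 _); apply: val_inj; rewrite /= inordK.
- move/(admissibleP _ N0): adm.
  rewrite kernel_opt; last by apply: C1E; rewrite prednK.
  rewrite opt_kernel1// -opt_coef0E//.
  by move=> /eqP; rewrite addrC addr_eq0 => /eqP.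
Qed.

Lemma continuous_opt_kernel (R : realType) (N i : nat) : continuous (@opt_kernel R N i).
Proof.
move=> x; apply: differentiable_continuous; apply/derivable1_diffP.
apply: ex_derive.
Qed.

(** By [kernelE] these multiples of e^x are exactly the differences between a kernel and the optimal
    one. *)
Lemma opt_kernel_orthogonal (R : realType) (N : nat) (d : nat -> R) : (0 < N)%N ->
  pairing N (fun i x => d i * expR x) (@opt_kernel R N) = 0.
Proof.
move=> N0; apply: big1 => i _.
have e1 := expR_step_gt1 R N0.
(* An explicit antiderivative; its increment over the piece vanishes by the choice of
   [opt_scale]. *)
pose F x : R := d i * (opt_scale R N / 2 * expR (- node R N i) * (expR x * expR x) -
  (x - node R N i - step R N / 2) * expR x).
have dF (x : R) : is_derive x 1 F (d i * expR x * opt_kernel N i x).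
  apply: is_derive_eq; rewrite /GRing.scale/= /opt_kernel expRD; by field.
have cF : continuous F.
  by move=> x; apply: differentiable_continuous; apply/derivable1_diffP; case: (dF x).
rewrite /Rintegral (@continuous_FTC2 _ _ F).
- rewrite -EFinB /=; rewrite /F nodeS !expRD expRN.
  move: e1; set E := expR (step R N) => e1; set P := expR (node R N i).
  have P0 : 0 < P by exact: expR_gt0.
  by rewrite /opt_scale -/E; field; rewrite (gt_eqF P0) gt_eqF// subr_gt0.
- by rewrite nodeS ltrDl step_gt0.
- apply: continuous_subspaceT => x; apply: cvgM; last exact: continuous_opt_kernel.
  by apply: cvgM; [exact: cvg_cst|exact: continuous_expR].
- split; first by move=> x _; case: (dF x).
  + by apply: cvg_at_right_filter; exact: cF.
  + by apply: cvg_at_left_filter; exact: cF.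
- by move=> x _; rewrite derive1E; case: (dF x).
Qed.

(* opt_kernel takes the same value at both ends of every piece, so the pieces
   glue: extend each one constantly outside its piece and add up the increments. *)
Lemma opt_kernel_glue (R : realType) (N : nat) : (0 < N)%N ->
  exists2 K : R -> R, continuous K & forall i x, (i < N)%N ->
    node R N i <= x <= node R N i.+1 -> K x = opt_kernel N i x.
Proof.
move=> N0; pose k0 := opt_scale R N + step R N / 2 - 1.
pose cl i x := Num.max (node R N i) (Num.min x (node R N i.+1)).
exists (fun x => k0 + \sum_(i < N) (opt_kernel N i (cl i x) - k0)).
  move=> x; apply: cvgD; first exact: cvg_cst.
  apply: cvg_big => [|i _]; first exact: add_continuous.
  apply: cvgB; last exact: cvg_cst.
  apply: (@continuous_comp _ _ _ (cl i)); last exact: continuous_opt_kernel.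
  apply: (@continuous_max _ _ (fun=> node R N i) (fun x => Num.min x (node R N i.+1))).
    exact: cst_continuous.
  apply: (@continuous_min _ _ id (fun=> node R N i.+1)); first exact: id.
  exact: cst_continuous.
move=> j x jN /andP[jx xj].
rewrite (bigD1 (Ordinal jN)) //= big1 ?addr0.
  by rewrite /cl (min_idPl xj) (max_idPr jx) addrC subrK.
move=> i ij; have [lt_ij|] := ltnP i j.
  have H : node R N i.+1 <= x by apply: le_trans jx; exact: node_le.
  rewrite /cl (min_idPr H) (max_idPr _) ?node_le//.
  by rewrite opt_kernel_nodeS// subrr.
rewrite leq_eqVlt => /predU1P[ji|lt_ji].
  by move: ij; rewrite -val_eqE /= ji eqxx.
have H : x <= node R N i by apply: le_trans xj _; exact: node_le.
rewrite /cl (max_idPl _) ?opt_kernel_node ?subrr//.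
by rewrite ge_min H.
Qed.

(** Both sides agree at [s = 0], so their linear terms must agree, which gives [M * a = M * b]. If
    [M] is 0, both [a] and [b] vanish. *)
Lemma quadratic_le_eq (R : realType) (M a b c : R) : 0 <= M -> b ^+ 2 <= M * c ->
  (forall s : R, (M + s * a) ^+ 2 <= M * (M + 2 * s * b + s ^+ 2 * c)) -> a = b.
Proof.
move=> M0 bc H.
(* Adding the cases [s = 1] and [s = -1] cancels the linear terms. *)
have C0 : 0 <= M * c - a ^+ 2 by have := H 1; have := H (-1); nra.
have : (M * (a - b)) ^+ 2 <= (M * c - a ^+ 2) * 0.
  by apply: discriminant_le => // s; have := H s; nra.
rewrite mulr0 => H0.
have : M * (a - b) = 0 by apply/eqP; rewrite -sqrf_eq0 eq_le H0 sqr_ge0.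
move=> /eqP; rewrite mulf_eq0 subr_eq0 => /predU1P[M00|/eqP//].
have a0 : a ^+ 2 <= 0 by move: C0; rewrite M00 mul0r; lra.
have b0 : b ^+ 2 <= 0 by move: bc; rewrite M00 mul0r.
have z (y : R) : y ^+ 2 <= 0 -> y = 0.
  by move=> y0; apply/eqP; rewrite -sqrf_eq0 eq_le y0 sqr_ge0.
by rewrite (z a)// (z b).
Qed.

(** The factor e^(-x) cancels e^x, and the positive part of a parabola vanishing at both ends of
    piece [j] isolates [d j]; h^3 / 6 is the area of its arch. *)
Lemma bump_test (R : realType) (N j : nat) (d : nat -> R) : (j < N)%N ->
  exists2 w : R -> R, continuous w &
    pairing N (fun i x => d i * expR x) (fun=> w) = d j * (step R N ^+ 3 / 6).
Proof.
move=> jN; have N0 : (0 < N)%N by exact: leq_ltn_trans jN.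
pose q x := (x - node R N j) * (node R N j.+1 - x).
exists (fun x => expR (- x) * Num.max 0 (q x)).
  have cq : continuous q.
    move=> x; apply: differentiable_continuous; apply/derivable1_diffP.
    apply: ex_derive.
  move=> x; apply: cvgM.
    apply: (@continuous_comp _ _ _ (fun x : R => - x)); first exact: continuousN.
    exact: continuous_expR.
  by apply: (@continuous_max _ _ (fun=> 0) q); [exact: cst_continuous|exact: cq].
rewrite /pairing (bigD1 (Ordinal jN)) //= big1 ?addr0; last first.
  move=> i ij; rewrite (@eq_Rintegral _ _ _ _ _ (fun=> 0)).
    by rewrite Rintegral_cst ?mul0r//; exact: measurable_itv.
  move=> x; rewrite inE/= in_itv/= => /andP[ix xi].
  rewrite (max_idPl _) ?mulr0//; rewrite /q.
  have [lt_ij|] := ltnP i j.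
    have H : x <= node R N j by apply: le_trans xi _; exact: node_le.
    have := node_le R N (leqnSn j); nra.
  rewrite leq_eqVlt => /predU1P[ji|lt_ji].
    by move: ij; rewrite -val_eqE /= ji eqxx.
  have H : node R N j.+1 <= x by apply: le_trans ix; exact: node_le.
  have := node_le R N (leqnSn j); nra.
have -> : \int[lebesgue_measure]_(x in `[node R N j, node R N j.+1])
    (d j * expR x * (expR (- x) * Num.max 0 (q x))) =
    \int[lebesgue_measure]_(x in `[node R N j, node R N j.+1]) (d j * q x).
  apply: eq_Rintegral => x; rewrite inE/= in_itv/= => /andP[jx xj].
  rewrite (max_idPr _); last by rewrite mulr_ge0// subr_ge0.
  by rewrite mulrA -(mulrA (d j)) -expRD subrr expR0 mulr1.
pose F (x : R) := d j * (step R N / 2 * (x - node R N j) ^+ 2 -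
  (x - node R N j) ^+ 3 / 3).
have dF (x : R) : is_derive x 1 F (d j * q x).
  apply: is_derive_eq; rewrite /GRing.scale/= /q nodeS; by field.
have cF : continuous F.
  by move=> x; apply: differentiable_continuous; apply/derivable1_diffP; case: (dF x).
rewrite /Rintegral (@continuous_FTC2 _ _ F).
- by rewrite -EFinB /= /F nodeS; field.
- by rewrite nodeS ltrDl step_gt0.
- apply: continuous_subspaceT => x.
  apply: differentiable_continuous; apply/derivable1_diffP; apply: ex_derive.
- split; first by move=> x _; case: (dF x).
  + by apply: cvg_at_right_filter; exact: cF.
  + by apply: cvg_at_left_filter; exact: cF.
- by move=> x _; rewrite derive1E; case: (dF x).
Qed.

(** The optimal kernel is itself a legitimate test function. Varying it by [s * w] and comparing
    first-order terms shows that the deviation [u] is orthogonal to every continuous [w]; bumps then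
    give [d i = 0]. *)
Lemma dual_norm_le_opt_kernel (R : realType) (N : nat) (C1 : 'I_N.+1 -> R) :
  (0 < N)%N -> admissible C1 ->
  (W221_dual_norm (error_functional C1) <=
   (Num.sqrt (pairing N (@opt_kernel R N) (@opt_kernel R N)))%:E)%E ->
  forall i, (i < N)%N -> kernel_coef C1 i = opt_scale R N * expR (- node R N i).
Proof.
move=> N0 adm normM; set M := pairing N _ _ in normM.
have M0 : 0 <= M by exact: pairing_ge0.
have [K cK KE] := opt_kernel_glue R N0.
pose d i := kernel_coef C1 i - opt_scale R N * expR (- node R N i).
pose u i x := d i * expR x.
have co i : continuous (@opt_kernel R N i) by exact: continuous_opt_kernel.
have cu i : continuous (u i).
  by move=> x; apply: cvgM; [exact: cvg_cst|exact: continuous_expR].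
have split_kernel w : (forall i, continuous (w i)) ->
    pairing N (kernel C1) w = pairing N (@opt_kernel R N) w + pairing N u w.
  move=> cw; transitivity (pairing N
      (fun i x => 1 * opt_kernel N i x + 1 * u i x) w).
    by apply: eq_pairing => // i x _ _; rewrite kernelE (mul1r (u i x)).
  by rewrite pairing_lin ?mul1r//; exact: pairing_continuous.
have orth (w : R -> R) : continuous w -> pairing N u (fun=> w) = 0.
  move=> cw; pose o := @opt_kernel R N; pose w' (i : nat) := w.
  have cw' i : continuous (w' i) by [].
  have bc := pairing_CauchySchwarz (pairing_continuous (N := N) co co)
    (pairing_continuous co cw') (pairing_continuous cw' cw').
  suff : pairing N (kernel C1) w' = pairing N o w'.
    by rewrite split_kernel// => H; apply: (addrI (pairing N o w')); rewrite addr0.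
  apply: (quadratic_le_eq M0 bc) => s.
  have cs : continuous (fun x => 1 * K x + s * w x).
    by move=> x; apply: cvgD; apply: cvgM; try exact: cvg_cst; [exact: cK|exact: cw].
  have := W221_dual_norm_test N0 adm M0 normM cs.
  (* [K] supplies the continuity required of a test function; inside the pairing it may be exchanged
     for the pieces of [opt_kernel]. *)
  have glue v : pairing N v (fun _ x => 1 * K x + s * w x) =
      pairing N v (fun i x => 1 * o i x + s * w' i x).
    by apply: eq_pairing => // i x iN xi; rewrite (KE i).
  have -> : pairing N (fun _ x => 1 * K x + s * w x) (fun _ x => 1 * K x + s * w x)
     = M + 2 * s * pairing N o w' + s ^+ 2 * pairing N w' w'.
    rewrite glue pairingC glue pairing_sqr_lin; try exact: pairing_continuous.
    by rewrite (pairingC N w').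
  rewrite glue pairingC pairing_lin; try exact: pairing_continuous.
  (* The kernel of [C1] pairs with the optimal one to exactly [M], since their difference is
     orthogonal to the latter. *)
  - rewrite mul1r (pairingC N o) (pairingC N w') [pairing N _ o]split_kernel//.
    by rewrite (opt_kernel_orthogonal d N0) addr0.
  - by apply: pairing_continuous => // i; exact: continuous_kernel.
  - by apply: pairing_continuous => // i; exact: continuous_kernel.
move=> i iN; have [w cw] := bump_test d iN.
rewrite -/u orth// => /esym/eqP; rewrite mulf_eq0 subr_eq0 => /predU1P[//|].
by rewrite mulf_eq0 invr_eq0 expf_eq0 /= !gt_eqF ?ltr0n// step_gt0.
Qed.

Theorem theorem3 (R : realType) (N : nat) (hN : (1 <= N)%N)
    (C1 : 'I_N.+1 -> R) :
  let h : R := step R N in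
  optimal C1 <->
  [/\ C1 ord0 = h * (expR h + 1) / (2 * (expR h - 1)) - 1,
      forall b : 'I_N.+1, (1 <= b <= N.-1)%N -> C1 b = 0
    & C1 ord_max = 1 - h * (expR h + 1) / (2 * (expR h - 1))].
Proof.
move=> h; rewrite -(opprB _ 1) -/(opt_coef0 R N).
set M := Num.sqrt (pairing N (@opt_kernel R N) (@opt_kernel R N)).
have opt_norm (D : 'I_N.+1 -> R) : D ord0 = opt_coef0 R N ->
    (forall b : 'I_N.+1, (1 <= b <= N.-1)%N -> D b = 0) ->
    D ord_max = - opt_coef0 R N ->
    admissible D /\ (W221_dual_norm (error_functional D) <= M%:E)%E.
  move=> D0 Db DN; have DE := opt_coefs_kernel hN D0 Db.
  have adm := opt_coefs_admissible hN DN DE; split=> //.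
  have := W221_dual_norm_le hN adm; congr (_ <= (Num.sqrt _)%:E)%E.
  by apply: eq_pairing => // i x iN _; rewrite kernel_opt ?DE.
have opt_unique (D : 'I_N.+1 -> R) : admissible D ->
    (W221_dual_norm (error_functional D) <= M%:E)%E ->
    [/\ D ord0 = opt_coef0 R N,
      forall b : 'I_N.+1, (1 <= b <= N.-1)%N -> D b = 0
    & D ord_max = - opt_coef0 R N].
  by move=> adm /(dual_norm_le_opt_kernel hN adm); exact: kernel_opt_coefs.
split=> [[adm normE]|[C10 C1b C1N]].
  apply: opt_unique => //; rewrite normE.
  (* The explicit coefficients, as a competitor bounding the infimum by [M]; [ord0] and [ord_max]
     differ because [N] is positive. *)
  pose D (b : 'I_N.+1) := if b == ord0 then opt_coef0 R N
    else if b == ord_max then - opt_coef0 R N else 0.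
  have [|b bN||admD normD] := opt_norm D.
  - by rewrite /D eqxx.
  - rewrite /D -!val_eqE /= !ifF//; apply/negbTE; rewrite -?lt0n; case/andP: bN => //.
    by move=> _; rewrite -ltnS prednK// => /ltn_eqF ->.
  - by rewrite /D eqxx -val_eqE /= (gtn_eqF hN).
  - by apply: le_trans normD; apply: ereal_inf_lbound; exists D.
have [adm normM] := opt_norm C1 C10 C1b C1N; split=> //.
apply/eqP; rewrite eq_le; apply/andP; split; last first.
  by apply: ereal_inf_lbound; exists C1.
apply: le_ereal_inf_tmp => _ [D /= admD <-].
(* A competitor either has norm above [M], hence at least that of [C1], or coincides with [C1] by
   [opt_unique]. *)
have [normD|/ltW] := leP (W221_dual_norm (error_functional D)) M%:E; last first.
  exact: le_trans.
have [D0 Db DN] := opt_unique D admD normD.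
suff -> : C1 = D by [].
apply/funext => b; have [->|b0] := eqVneq b ord0; first by rewrite C10.
have [->|bN] := eqVneq b ord_max; first by rewrite C1N.
have b1N : (1 <= b <= N.-1)%N.
  apply/andP; split; first by rewrite lt0n.
  by rewrite -ltnS prednK// ltn_neqAle -ltnS ltn_ord andbT.
by rewrite C1b// Db.
Qed.
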